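(* Let $\mathbb{T}$ be a time scale with $0\in\mathbb{T}$ and graininess $\mu$, and let $\alpha,\omega:\mathbb{T}\to\mathbb{C}$ be rd-continuous functions with $\alpha\mu\neq\pm2$ and $\omega\mu\neq\pm2i$ on $\mathbb{T}$. Then $$\mathrm{Cosh}_\alpha^2(t)-\mathrm{Sinh}_\alpha^2(t)=1,\qquad \mathrm{Cos}_\omega^2(t)+\mathrm{Sin}_\omega^2(t)=1,$$ $$\mathrm{Cosh}_\alpha^\Delta(t)=\alpha(t)\,\langle\mathrm{Sinh}_\alpha(t)\rangle,\qquad \mathrm{Sinh}_\alpha^\Delta(t)=\alpha(t)\,\langle\mathrm{Cosh}_\alpha(t)\rangle,$$ $$\mathrm{Cos}_\omega^\Delta(t)=-\omega(t)\,\langle\mathrm{Sin}_\omega(t)\rangle,\qquad \mathrm{Sin}_\omega^\Delta(t)=\omega(t)\,\langle\mathrm{Cos}_\omega(t)\rangle.$$ The first two identities hold for all $t\in\mathbb{T}$ and the remaining four for all $t\in\mathbb{T}^\kappa$.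
   Context: A time scale $\mathbb{T}$ is a non-empty closed subset of $\mathbb{R}$. Forward jump: $\sigma(t)=t^\sigma=\inf\{s\in\mathbb{T}: s>t\}$ (with $\inf\emptyset=\sup\mathbb{T}$); backward jump: $\rho(t)=\sup\{s\in\mathbb{T}:s<t\}$ (with $\sup\emptyset=\inf\mathbb{T}$); graininess: $\mu(t)=\sigma(t)-t$. A point $t$ is right-dense if $\sigma(t)=t$, right-scattered if $\sigma(t)>t$, left-dense if $\rho(t)=t$, left-scattered if $\rho(t)<t$. A function is rd-continuous if it is continuous at right-dense points and has a finite (left) limit at left-dense points. The delta derivative is $f^\Delta(t)=\lim_{s\to t,\ s\neq\sigma(t)}\frac{f(\sigma(t))-f(s)}{\sigma(t)-s}$ (so $f^\Delta(t)=(f(\sigma(t))-f(t))/\mu(t)$ at a right-scattered $t$ where $f$ is continuous); it is considered at points $t\in\mathbb{T}^\kappa$, i.e. $\mathbb{T}$ with a left-scattered maximum (if there is one) removed. Write $\langle x(t)\rangle=\frac{x(t)+x(t^\sigma)}{2}$. The Cayley-exponential function $E_\alpha(t,t_0)$, for $\alpha:\mathbb{T}\to\mathbb{C}$ rd-continuous with $\mu\alpha\neq\pm2$ on $\mathbb{T}$, is the solution of $x^\Delta(t)=\alpha(t)\langle x(t)\rangle$, $x(t_0)=1$. One writes $E_\alpha(t):=E_\alpha(t,0)$. Cayley-hyperbolic and Cayley-trigonometric functions are defined by $$\mathrm{Cosh}_\alpha(t)=\frac{E_\alpha(t)+E_{-\alpha}(t)}{2},\qquad \mathrm{Sinh}_\alpha(t)=\frac{E_\alpha(t)-E_{-\alpha}(t)}{2},$$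 $$\mathrm{Cos}_\omega(t)=\frac{E_{i\omega}(t)+E_{-i\omega}(t)}{2},\qquad \mathrm{Sin}_\omega(t)=\frac{E_{i\omega}(t)-E_{-i\omega}(t)}{2i}.$$ *)

(* Defs.v *)
From Stdlib Require Import Reals ClassicalEpsilon.
From Coquelicot Require Import Coquelicot.

Open Scope C_scope.

(* A time scale is a subset [T : R -> Prop] of the real line.  A function on it
   is a function [R -> C] of which only the values at points of [T] matter. *)
Definition time_scale (T : R -> Prop) : Prop :=
  (exists t, T t) /\ closed T.

(* The case split is needed because [Glb_Rbar] of the empty set is [p_infty],
   whereas here inf (empty) = sup T (and dually for the backward jump).  In each
   branch taken at a point of [T] the bound is finite, so [real] loses nothing. *)
Definition sigma (T : R -> Prop) (t : R) : R :=
  if excluded_middle_informative (exists s, T s /\ (t < s)%R)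
  then real (Glb_Rbar (fun s => T s /\ (t < s)%R))
  else real (Lub_Rbar T).

Definition rho (T : R -> Prop) (t : R) : R :=
  if excluded_middle_informative (exists s, T s /\ (s < t)%R)
  then real (Lub_Rbar (fun s => T s /\ (s < t)%R))
  else real (Glb_Rbar T).

Definition graininess (T : R -> Prop) (t : R) : R := (sigma T t - t)%R.

Definition right_dense (T : R -> Prop) (t : R) : Prop := sigma T t = t.
Definition left_dense (T : R -> Prop) (t : R) : Prop := rho T t = t.
Definition left_scattered (T : R -> Prop) (t : R) : Prop := (rho T t < t)%R.

Definition is_maximum (T : R -> Prop) (t : R) : Prop :=
  T t /\ forall s, T s -> (s <= t)%R.

Definition Tkappa (T : R -> Prop) (t : R) : Prop :=
  T t /\ ~ (is_maximum T t /\ left_scattered T t).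

Definition rd_continuous (T : R -> Prop) (f : R -> C) : Prop :=
  forall t, T t ->
    (right_dense T t -> filterlim f (within T (locally t)) (locally (f t))) /\
    (left_dense T t ->
       exists l : C,
         filterlim f (within (fun s => T s /\ (s < t)%R) (locally t)) (locally l)).

(* [s] may be equal to [t] when [t] is right-scattered, so that the existence of
   the derivative there includes the continuity of [f] at [t]. *)
Definition is_delta_derive (T : R -> Prop) (f : R -> C) (t : R) (l : C) : Prop :=
  filterlim (fun s : R => (f (sigma T t) - f s) / RtoC (sigma T t - s)%R)
    (within (fun s => T s /\ s <> sigma T t) (locally t)) (locally l).

Definition mean (T : R -> Prop) (x : R -> C) (t : R) : C :=
  (x t + x (sigma T t)) / 2.

Definition cayley_ivp (T : R -> Prop) (alpha : R -> C) (t0 : R) (x : R -> C) : Prop :=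
  x t0 = 1 /\
  forall t, Tkappa T t -> is_delta_derive T x t (alpha t * mean T x t).

(* "The" solution is selected by [epsilon]: when a solution exists,
   [cayley_exp T alpha t0] satisfies [cayley_ivp T alpha t0].  Its values off [T]
   are arbitrary. *)
Definition cayley_exp (T : R -> Prop) (alpha : R -> C) (t0 : R) : R -> C :=
  epsilon (inhabits (fun _ : R => RtoC 1)) (cayley_ivp T alpha t0).

Definition E (T : R -> Prop) (alpha : R -> C) : R -> C := cayley_exp T alpha 0.

Definition Cosh (T : R -> Prop) (alpha : R -> C) (t : R) : C :=
  (E T alpha t + E T (fun s => - alpha s) t) / 2.

Definition Sinh (T : R -> Prop) (alpha : R -> C) (t : R) : C :=
  (E T alpha t - E T (fun s => - alpha s) t) / 2.

Definition Cos (T : R -> Prop) (omega : R -> C) (t : R) : C :=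
  (E T (fun s => Ci * omega s) t + E T (fun s => - (Ci * omega s)) t) / 2.

Definition Sin (T : R -> Prop) (omega : R -> C) (t : R) : C :=
  (E T (fun s => Ci * omega s) t - E T (fun s => - (Ci * omega s)) t) / (2 * Ci).

(* Main.v *)
From Pilot Require Import Defs.
From Stdlib Require Import Reals.
From Coquelicot Require Import Coquelicot.
From Stdlib Require Import Lra ClassicalEpsilon.
Open Scope C_scope.

(** Two facts carry the theorem.  First, the Cayley-exponential exists: the
    initial value problem [x^Delta = alpha <x>], [x t0 = 1] is solvable on the
    whole time scale, so [E_solves] gives the equation for [E].  The four
    derivative formulas are then linear combinations of the equations of
    [E alpha] and [E (- alpha)] ([cayley_half_sum_difference]).  Second,
    [E alpha * E (- alpha) = 1] ([cayley_product_one]); both quadratic identities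
    are this product rewritten by [((x + y) / 2)^2 - ((x - y) / 2)^2 = x y].

    For the product, the delta derivative obeys the symmetric Leibniz rule
    [(x y)^Delta = x^Delta <y> + <x> y^Delta] ([delta_derive_mult]).  With
    [x^Delta = alpha <x>] and [y^Delta = - alpha <y>] it vanishes, and a function
    whose delta derivative vanishes is constant ([zero_delta_derive_constant],
    by induction along the real line).

    For existence, write [x = exp F].  Across a gap of length [mu] the equation
    forces [x] to be multiplied by the Cayley transform
    [(1 + mu alpha / 2) / (1 - mu alpha / 2)], which is finite and nonzero exactly
    because [mu alpha] is neither [2] nor [-2].  So [F] must have delta
    derivative [a = Log (Cayley (mu alpha)) / mu] at right-scattered points and
    [a = alpha] at right-dense ones.  Any branch of the logarithm is good enough
    as long as it tends to [0] at [1], because then [a] differs little from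
    [alpha] where [mu] is small ([cayley_logarithm]), and [a] is again
    rd-continuous ([cylinder_rd_continuous]).  An rd-continuous function [a] has
    an antiderivative ([rd_continuous_antiderivative]): extended to the gaps by
    its value at their left ends it has one-sided limits everywhere, hence is
    Riemann integrable, and the primitive of the extension works.  The
    exponential never vanishes, so both sides of [t0] are treated alike. *)

(* The name [sigma] also denotes a finite sum of reals. *)
Local Notation sigma := Pilot.Defs.sigma.

(** * The complex exponential and the Cayley transform *)

Lemma Cmod_le_components (z : C) : (Cmod z <= Rabs (fst z) + Rabs (snd z))%R.
Proof.
  replace z with (RtoC (fst z) + Ci * RtoC (snd z)).
  - eapply Rle_trans; [apply Cmod_triangle|].
    rewrite Cmod_mult, Cmod_Ci, !Cmod_R, Rmult_1_l.
    destruct z; unfold Ci, RtoC, Cplus, Cmult; simpl.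
    right; do 2 f_equal; ring.
  - destruct z; unfold Ci, RtoC, Cplus, Cmult; simpl; f_equal; ring.
Qed.

Lemma Cmod_fst (z : C) : (Rabs (fst z) <= Cmod z)%R.
Proof. eapply Rle_trans; [apply Rmax_l|apply Rmax_Cmod]. Qed.

Lemma Cmod_snd (z : C) : (Rabs (snd z) <= Cmod z)%R.
Proof. eapply Rle_trans; [apply Rmax_r|apply Rmax_Cmod]. Qed.

Lemma Cmod_minus_sym (x y : C) : Cmod (x - y) = Cmod (y - x).
Proof. rewrite <- Cmod_opp; f_equal; ring. Qed.

Lemma Cmod_minus_1_le (z : C) : (Rabs (Cmod z - 1) <= Cmod (z - 1))%R.
Proof.
  assert (A := Cmod_triangle (z - 1) 1).
  assert (B := Cmod_triangle (1 - z) z).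
  replace (z - 1 + 1) with z in A by ring.
  replace (1 - z + z) with (RtoC 1) in B by ring.
  rewrite (Cmod_minus_sym 1) in B. rewrite Cmod_1 in A, B.
  apply Rabs_le; lra.
Qed.

Definition Cexp (z : C) : C := (exp (fst z) * cos (snd z), exp (fst z) * sin (snd z))%R.

Lemma Cexp_plus (z w : C) : Cexp (z + w) = Cexp z * Cexp w.
Proof.
  unfold Cexp, Cmult; simpl. rewrite exp_plus, cos_plus, sin_plus.
  f_equal; ring.
Qed.

Lemma Cexp_0 : Cexp 0 = 1.
Proof. unfold Cexp; simpl. rewrite exp_0, cos_0, sin_0. unfold RtoC; f_equal; ring. Qed.

(** The difference quotient cleared of its denominator, so that the point [0]
    needs no exception. *)
Lemma derivative_estimate (f : R -> R) (l : R) (hf : derivable_pt_lim f 0 l)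
  (eps : R) (heps : (0 < eps)%R) :
  exists delta, (0 < delta)%R /\
    forall x, (Rabs x < delta)%R -> (Rabs (f x - f 0 - l * x) <= eps * Rabs x)%R.
Proof.
  destruct (hf eps heps) as [d hd]. exists d; split; [apply cond_pos|].
  intros x hx. destruct (Req_dec x 0) as [->|nx].
  - replace (f 0 - f 0 - l * 0)%R with 0%R by ring. rewrite Rabs_R0; lra.
  - specialize (hd x nx hx). rewrite Rplus_0_l in hd.
    replace (f x - f 0 - l * x)%R with (((f x - f 0) / x - l) * x)%R by (now field).
    rewrite Rabs_mult. apply Rmult_le_compat_r; [apply Rabs_pos|lra].
Qed.

Lemma Cexp_estimate (eps : R) (heps : (0 < eps)%R) :
  exists delta, (0 < delta)%R /\
    forall z, (Cmod z < delta)%R -> (Cmod (Cexp z - 1 - z) <= eps * Cmod z)%R.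
Proof.
  (* The error terms collected at the end add up to 9 e |z|. *)
  set (e := Rmin (eps / 11) 1).
  assert (he : (0 < e)%R) by (apply Rmin_case; lra).
  assert (he1 : (e <= 1)%R) by apply Rmin_r.
  assert (he2 : (e <= eps / 11)%R) by apply Rmin_l.
  destruct (derivative_estimate exp 1) with (eps := e) as (d1 & hd1 & H1); trivial.
  { rewrite <- exp_0. apply derivable_pt_lim_exp. }
  destruct (derivative_estimate cos 0) with (eps := e) as (d2 & hd2 & H2); trivial.
  { replace 0%R with (- sin 0)%R at 2 by (rewrite sin_0; ring). apply derivable_pt_lim_cos. }
  destruct (derivative_estimate sin 1) with (eps := e) as (d3 & hd3 & H3); trivial.
  { rewrite <- cos_0. apply derivable_pt_lim_sin. }
  exists (Rmin e (Rmin d1 (Rmin d2 d3))). split.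
  { repeat apply Rmin_case; lra. }
  intros z hz.
  assert (hz0 := Rmin_l e (Rmin d1 (Rmin d2 d3))).
  assert (hz1 := Rmin_r e (Rmin d1 (Rmin d2 d3))).
  assert (hz2 := Rmin_l d1 (Rmin d2 d3)). assert (hz3 := Rmin_r d1 (Rmin d2 d3)).
  assert (hz4 := Rmin_l d2 d3). assert (hz5 := Rmin_r d2 d3).
  assert (hf := Cmod_fst z). assert (hs := Cmod_snd z).
  destruct z as [x y]. simpl in hf, hs. set (r := Cmod (x, y)) in *.
  specialize (H1 x). specialize (H2 y). specialize (H3 y).
  rewrite exp_0 in H1. rewrite cos_0 in H2. rewrite sin_0 in H3.
  specialize (H1 ltac:(lra)). specialize (H2 ltac:(lra)). specialize (H3 ltac:(lra)).
  rewrite Rmult_1_l in H1, H3. rewrite Rmult_0_l in H2. rewrite !Rminus_0_r in *.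
  assert (hx0 := Rabs_pos x). assert (hy0 := Rabs_pos y).
  assert (hex : (Rabs (exp x - 1) <= 2 * Rabs x)%R).
  { replace (exp x - 1)%R with ((exp x - 1 - x) + x)%R by ring.
    eapply Rle_trans; [apply Rabs_triang|]. nra. }
  assert (hexp : (Rabs (exp x) <= 3)%R).
  { replace (exp x)%R with ((exp x - 1) + 1)%R by ring.
    eapply Rle_trans; [apply Rabs_triang|]. rewrite (Rabs_right 1); lra. }
  eapply Rle_trans; [apply Cmod_le_components|]. simpl.
  replace (exp x * cos y + - (1) + - x)%R
    with ((exp x - 1 - x) + exp x * (cos y - 1))%R by ring.
  replace (exp x * sin y + - 0 + - y)%R
    with (exp x * (sin y - y) + (exp x - 1) * y)%R by ring.
  assert (K1 := Rabs_triang (exp x - 1 - x) (exp x * (cos y - 1))).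
  assert (K2 := Rabs_triang (exp x * (sin y - y)) ((exp x - 1) * y)).
  rewrite !Rabs_mult in K1. rewrite !Rabs_mult in K2.
  assert (M1 : (Rabs (exp x) * Rabs (cos y - 1) <= 3 * (e * r))%R).
  { apply Rmult_le_compat; try apply Rabs_pos; trivial. nra. }
  assert (M2 : (Rabs (exp x) * Rabs (sin y - y) <= 3 * (e * r))%R).
  { apply Rmult_le_compat; try apply Rabs_pos; trivial. nra. }
  assert (M3 : (Rabs (exp x - 1) * Rabs y <= (2 * e) * r)%R).
  { apply Rmult_le_compat; try apply Rabs_pos; trivial. nra. }
  assert (M4 : (e * Rabs x <= e * r)%R) by nra.
  assert (M5 : (e * r <= eps / 11 * r)%R) by (apply Rmult_le_compat_r; lra).
  assert (M6 : (0 <= eps * r)%R) by (apply Rmult_le_pos; lra).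
  lra.
Qed.

Lemma Cexp_polar_right (x y : R) (hx : (0 < x)%R) :
  Cexp (ln (sqrt (x * x + y * y)), atan (y / x)) = (x, y).
Proof.
  assert (h : (0 < x * x + y * y)%R) by nra.
  unfold Cexp; simpl. rewrite exp_ln by (now apply sqrt_lt_R0).
  rewrite cos_atan, sin_atan.
  replace (1 + (y / x)²)%R with ((x * x + y * y) / (x * x))%R
    by (unfold Rsqr; field; lra).
  rewrite sqrt_div by nra. rewrite sqrt_square by lra.
  assert (sqrt (x * x + y * y) <> 0)%R by (apply Rgt_not_eq, sqrt_lt_R0; lra).
  f_equal; field; lra.
Qed.

(** The right half plane is covered by [Cexp_polar_right]; rotating by half a
    turn covers the left one, and the imaginary axis is done by hand. *)
Lemma Cexp_surjective (z : C) (hz : z <> 0) : exists w, Cexp w = z.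
Proof.
  assert (Hneg : forall u v, Cexp u = v -> Cexp (u + (0, PI)%R) = - v).
  { intros u v <-. rewrite Cexp_plus. unfold Cexp at 2; simpl.
    rewrite exp_0, cos_PI, sin_PI. unfold Cmult, Copp; simpl. f_equal; ring. }
  destruct z as [x y].
  destruct (total_order_T 0 x) as [[hx|hx]|hx].
  - eexists; now apply Cexp_polar_right.
  - subst x.
    assert (hy : y <> 0%R) by (intros ->; now apply hz).
    assert (Hpos : forall b, (0 < b)%R -> Cexp (ln b, PI / 2)%R = (0%R, b)).
    { intros b hb. unfold Cexp; simpl. rewrite cos_PI2, sin_PI2, exp_ln by trivial.
      f_equal; ring. }
    destruct (Rlt_le_dec 0 y) as [hy'|hy'].
    + eexists; now apply Hpos.
    + eexists. erewrite Hneg; [|apply (Hpos (- y)%R); lra].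
      unfold Copp; simpl; f_equal; ring.
  - eexists. erewrite Hneg; [|apply (Cexp_polar_right (- x) (- y)); lra].
    unfold Copp; simpl; f_equal; ring.
Qed.

(** Near [1] the logarithm is the explicit one of the right half plane, which is
    continuous there; elsewhere an arbitrary choice suffices. *)
Lemma complex_logarithm : exists L : C -> C,
  (forall z : C, z <> 0 -> Cexp (L z) = z) /\
  (forall eps, (0 < eps)%R -> exists delta, (0 < delta)%R /\
     forall z, (Cmod (z - 1) < delta)%R -> (Cmod (L z) < eps)%R).
Proof.
  exists (fun z : C =>
    if Rlt_dec 0 (fst z)
    then (ln (sqrt (fst z * fst z + snd z * snd z)), atan (snd z / fst z))
    else epsilon (inhabits (RtoC 0)) (fun w => Cexp w = z)).
  split.
  { intros z hz. destruct (Rlt_dec 0 (fst z)).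
    - destruct z; now apply Cexp_polar_right.
    - now apply epsilon_spec, Cexp_surjective. }
  intros eps heps.
  destruct (proj1 (filterlim_locally _ _)
     (continuous_comp (fun r : R => r) ln 1 (continuous_id _)
       (ex_derive_continuous ln 1 (ex_intro _ _ (is_derive_ln 1 Rlt_0_1))))
       (mkposreal (eps / 2) ltac:(lra))) as [d1 h1].
  destruct (proj1 (filterlim_locally _ _) (continuous_atan 0)
       (mkposreal (eps / 2) ltac:(lra))) as [d2 h2].
  rewrite ln_1 in h1. rewrite atan_0 in h2.
  assert (p1 := cond_pos d1). assert (p2 := cond_pos d2).
  exists (Rmin (1 / 2) (Rmin (d1 / 4) (d2 / 4))). split.
  { repeat apply Rmin_case; lra. }
  intros [x y] hz.
  assert (hz0 := Rmin_l (1 / 2) (Rmin (d1 / 4) (d2 / 4))).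
  assert (hz1 := Rmin_r (1 / 2) (Rmin (d1 / 4) (d2 / 4))).
  assert (hz2 := Rmin_l (d1 / 4) (d2 / 4)). assert (hz3 := Rmin_r (d1 / 4) (d2 / 4)).
  assert (hf := Cmod_fst ((x, y) - 1)). assert (hs := Cmod_snd ((x, y) - 1)).
  simpl in hf, hs. replace (y + - 0)%R with y in hs by ring.
  set (r := Cmod ((x, y) - 1)) in *.
  assert (hx : (Rabs (x + - (1)) < 1 / 2)%R) by lra.
  apply Rabs_def2 in hx.
  simpl. destruct (Rlt_dec 0 x) as [hx'|hx']; [|lra].
  assert (hm : sqrt (x * x + y * y) = Cmod (x, y)).
  { unfold Cmod; simpl; f_equal; ring. }
  assert (hm1 : (Rabs (Cmod (x, y) - 1) <= r)%R).
  { apply Cmod_minus_1_le. }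
  eapply Rle_lt_trans; [apply Cmod_le_components|]. simpl.
  rewrite hm.
  assert (A1 : (Rabs (ln (Cmod (x, y)) - 0) < eps / 2)%R).
  { apply (h1 (Cmod (x, y))). change (Rabs (Cmod (x, y) - 1) < d1)%R. lra. }
  assert (A2 : (Rabs (atan (y / x) - 0) < eps / 2)%R).
  { apply (h2 (y / x)%R). change (Rabs (y / x - 0) < d2)%R.
    rewrite Rminus_0_r. unfold Rdiv. rewrite Rabs_mult, Rabs_inv, (Rabs_right x) by lra.
    assert (/ x <= 2)%R.
    { replace 2%R with (/ (1 / 2))%R by field. apply Rinv_le_contravar; lra. }
    assert (0 < / x)%R by (apply Rinv_0_lt_compat; lra).
    assert (Hy := Rabs_pos y). nra. }
  rewrite Rminus_0_r in A1, A2. lra.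
Qed.

Definition cayley (w : C) : C := (1 + w / 2) / (1 - w / 2).

Lemma cayley_denominator (w : C) (hw : w <> 2) : 1 - w / 2 <> 0.
Proof.
  intros h. apply hw. replace w with (2 - 2 * (1 - w / 2)) by (field; intros q; injection q; lra).
  rewrite h; ring.
Qed.

Lemma cayley_mult_denominator (w : C) (hw : w <> 2) : cayley w * (1 - w / 2) = 1 + w / 2.
Proof.
  unfold cayley. set (d := 1 - w / 2). unfold Cdiv at 1.
  rewrite <- Cmult_assoc, Cinv_l; [ring|]. now apply cayley_denominator.
Qed.

Lemma C2_neq_0 : RtoC 2 <> 0.
Proof. intros q; injection q; lra. Qed.

Lemma cayley_neq_0 (w : C) (h1 : w <> 2) (h2 : w <> - (2)) : cayley w <> 0.
Proof.
  assert (hd := cayley_denominator w h1).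
  assert (hn : 1 + w / 2 <> 0).
  { intros h. apply h2. replace w with (- (2) + 2 * (1 + w / 2)) by (field; apply C2_neq_0).
    rewrite h; ring. }
  apply Cmult_neq_0; [trivial|].
  intros h. apply (Cinv_r (1 - w / 2)) in hd. rewrite h, Cmult_0_r in hd.
  injection hd; lra.
Qed.

Lemma cayley_estimate (w : C) (hw : (Cmod w <= 1)%R) :
  (Cmod (cayley w - 1 - w) <= Cmod w * Cmod w)%R.
Proof.
  assert (hn : (1 / 2 <= Cmod (1 - w / 2))%R).
  { assert (A := Cmod_triangle (1 - w / 2) (w / 2)).
    replace (1 - w / 2 + w / 2) with (RtoC 1) in A by ring.
    rewrite Cmod_1, (Cmod_div w 2) in A by apply C2_neq_0.
    rewrite Cmod_R, (Rabs_right 2) in A; lra. }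
  assert (h : 1 - w / 2 <> 0) by (apply Cmod_gt_0; lra).
  replace (cayley w - 1 - w) with (w * w / (2 * (1 - w / 2))).
  2:{ unfold cayley. field. intros q; apply h. cbv beta in q.
      replace (1 - w / 2) with ((2 - w) / 2) by (field; apply C2_neq_0).
      rewrite q. unfold Cdiv; ring. }
  rewrite Cmod_div, !Cmod_mult, Cmod_R, (Rabs_right 2).
  2: lra. 2: { apply Cmult_neq_0; [apply C2_neq_0|trivial]. }
  assert (hq : (0 <= Cmod w * Cmod w)%R) by (assert (H := Cmod_ge_0 w); nra).
  apply Rmult_le_reg_r with (2 * Cmod (1 - w / 2))%R; [lra|].
  unfold Rdiv. rewrite Rmult_assoc, Rinv_l by lra. nra.
Qed.

(** Both [Cexp v] and [cayley w] are [1] plus their argument up to a smaller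
    error, so the solution [v] of [Cexp v = cayley w] that tends to [0] with [w]
    is [w] up to a smaller error. *)
Lemma cayley_logarithm : exists Lambda : C -> C,
  (forall w : C, w <> 2 -> w <> - (2) -> Cexp (Lambda w) = cayley w) /\
  (forall eps, (0 < eps)%R -> exists delta, (0 < delta)%R /\
     forall w : C, (Cmod w < delta)%R -> (Cmod (Lambda w - w) <= eps * Cmod w)%R).
Proof.
  destruct complex_logarithm as (L & HL & HL1).
  exists (fun w : C => L (cayley w)). split.
  { intros w h1 h2. now apply HL, cayley_neq_0. }
  intros eps heps.
  set (e := Rmin (eps / 4) (1 / 2)).
  assert (he : (0 < e)%R) by (apply Rmin_case; lra).
  assert (he1 : (e <= eps / 4)%R) by apply Rmin_l.
  assert (he2 : (e <= 1 / 2)%R) by apply Rmin_r.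
  destruct (Cexp_estimate e he) as (d1 & hd1 & H1).
  destruct (HL1 d1 hd1) as (d2 & hd2 & H2).
  exists (Rmin e (d2 / 2)). split; [apply Rmin_case; lra|].
  intros w hw.
  assert (hw1 := Rmin_l e (d2 / 2)). assert (hw2 := Rmin_r e (d2 / 2)).
  assert (h0 := Cmod_ge_0 w).
  assert (hc := cayley_estimate w ltac:(lra)).
  assert (hc1 : (Cmod (cayley w - 1) < d2)%R).
  { replace (cayley w - 1) with ((cayley w - 1 - w) + w) by ring.
    eapply Rle_lt_trans; [apply Cmod_triangle|]. nra. }
  set (v := L (cayley w)).
  assert (hv := H1 v (H2 _ hc1)).
  assert (hE : Cexp v = cayley w).
  { apply HL. intros q. rewrite q in hc.
    replace (0 - 1 - w) with (- (1 + w)) in hc by ring.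
    rewrite Cmod_opp in hc.
    assert (A := Cmod_triangle (1 + w) (- w)). rewrite Cmod_opp in A.
    replace (1 + w + - w) with (RtoC 1) in A by ring. rewrite Cmod_1 in A. nra. }
  rewrite hE in hv.
  assert (A : (Cmod (v - w) <= Cmod (cayley w - 1 - v) + Cmod (cayley w - 1 - w))%R).
  { rewrite <- (Cmod_opp (cayley w - 1 - v)).
    replace (v - w) with (- (cayley w - 1 - v) + (cayley w - 1 - w)) by ring.
    apply Cmod_triangle. }
  assert (B : (Cmod v <= Cmod (v - w) + Cmod w)%R).
  { replace v with ((v - w) + w) at 1 by ring. apply Cmod_triangle. }
  assert (h3 := Cmod_ge_0 v). assert (h4 := Cmod_ge_0 (v - w)).
  (* [A] reads |v - w| <= e |v| + e |w|, which is at most e |v - w| + 2 e |w|;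
     as e <= 1/2, this gives |v - w| <= 4 e |w|. *)
  assert (D : (e * Cmod v <= 1 / 2 * Cmod (v - w) + e * Cmod w)%R) by nra.
  assert (F : (Cmod w * Cmod w <= e * Cmod w)%R) by nra.
  nra.
Qed.

(** * Primitives of functions with one-sided limits *)

(** The supremum of the points up to which [P] holds can be neither missed by
    [P] (left step) nor smaller than [b] (right step).  This replaces a covering
    argument in the integrability proof and a mean value theorem on the time
    scale. *)
Lemma real_induction (a b : R) (P : R -> Prop)
  (hbase : P a)
  (hright : forall x, (a <= x < b)%R -> P x ->
     exists delta, (0 < delta)%R /\ forall y, (x < y < x + delta)%R -> (y <= b)%R -> P y)
  (hleft : forall x, (a < x <= b)%R -> (forall y, (a <= y < x)%R -> P y) -> P x) :
  forall x, (a <= x <= b)%R -> P x.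
Proof.
  intros x0 hx0.
  set (S := fun x => (a <= x <= b)%R /\ forall y, (a <= y <= x)%R -> P y).
  assert (hSa : S a).
  { split; [lra|]. intros y hy. now replace y with a by lra. }
  destruct (completeness S) as [u [hu1 hu2]].
  { exists b. now intros x [hx _]. }
  { now exists a. }
  assert (hau : (a <= u)%R) by now apply hu1.
  assert (hub : (u <= b)%R) by (apply hu2; now intros x [hx _]).
  assert (hbelow : forall y, (a <= y < u)%R -> P y).
  { intros y hy. destruct (classic (exists x, S x /\ (y < x)%R)) as [(x & [_ hx] & hyx)|hn].
    - apply hx; lra.
    - exfalso. assert (u <= y)%R; [|lra]. apply hu2. intros x hx.
      destruct (Rle_lt_dec x y); trivial. exfalso; apply hn; now exists x. }
  assert (hu : P u).
  { destruct (Req_dec a u) as [<-|]; [trivial|]. apply hleft; [lra|trivial]. }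
  assert (hle : forall y, (a <= y <= u)%R -> P y).
  { intros y hy. destruct (Req_dec y u) as [->|]; [trivial|apply hbelow; lra]. }
  destruct (Rle_lt_dec b u) as [h|h]; [apply hle; lra|].
  exfalso. destruct (hright u) as (d & hd & H); [lra|trivial|].
  set (v := Rmin b (u + d / 2)).
  assert (huv : (u < v)%R) by (apply Rmin_case; lra).
  assert (v <= b)%R by apply Rmin_l.
  assert (v <= u + d / 2)%R by apply Rmin_r.
  assert (v <= u)%R; [|lra]. apply hu1. split; [lra|].
  intros y hy. destruct (Rle_lt_dec y u); [apply hle; lra|apply H; lra].
Qed.

(** One-sided oscillation arbitrarily small at every point; by completeness
    this is the existence of both one-sided limits. *)
Definition regulated (g : R -> R) : Prop :=
  forall x eps, (0 < eps)%R ->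
    (exists v delta, (0 < delta)%R /\
       forall s, (x < s < x + delta)%R -> (Rabs (g s - v) <= eps)%R) /\
    (exists v delta, (0 < delta)%R /\
       forall s, (x - delta < s < x)%R -> (Rabs (g s - v) <= eps)%R).

Lemma extend_by_constant (f h : R -> R) (a x y v eps : R)
  (haxy : (a <= x < y)%R) (heps : (0 < eps)%R)
  (hint : ex_RInt h a x) (hh : forall s, (a <= s <= x)%R -> (Rabs (f s - h s) <= eps)%R)
  (hv : forall s, (x < s < y)%R -> (Rabs (f s - v) <= eps)%R) :
  exists h', ex_RInt h' a y /\
    forall s, (a <= s <= y)%R -> (Rabs (f s - h' s) <= eps)%R.
Proof.
  exists (fun s => if Rle_dec s x then h s else if Rlt_dec s y then v else f s).
  split.
  - apply ex_RInt_Chasles with x.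
    + apply ex_RInt_ext with h; trivial.
      intros s. rewrite Rmin_left, Rmax_right by lra. intros hs.
      destruct (Rle_dec s x); [trivial|lra].
    + apply ex_RInt_ext with (fun _ => v); [|apply ex_RInt_const].
      intros s. rewrite Rmin_left, Rmax_right by lra. intros hs.
      destruct (Rle_dec s x); [lra|]. destruct (Rlt_dec s y); [trivial|lra].
  - intros s hs. destruct (Rle_dec s x); [apply hh; lra|].
    destruct (Rlt_dec s y); [apply hv; lra|].
    rewrite Rminus_diag, Rabs_R0; lra.
Qed.

(** The approximant is built from left to right by [real_induction], one
    constant piece at a time; values at the division points are copied from [f],
    which does not affect integrability. *)
Lemma regulated_approximation (f : R -> R) (a b eps : R)
  (hf : regulated f) (hab : (a <= b)%R) (heps : (0 < eps)%R) :
  exists h, ex_RInt h a b /\ forall s, (a <= s <= b)%R -> (Rabs (f s - h s) <= eps)%R.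
Proof.
  pattern b. eapply real_induction with (a := a) (b := b); [| | |lra].
  - exists f; split; [apply ex_RInt_point|].
    intros s _. rewrite Rminus_diag, Rabs_R0; lra.
  - intros x hx (h & h1 & h2).
    destruct (hf x eps heps) as [(v & d & hd & hv) _].
    exists d; split; trivial. intros y hy _.
    apply extend_by_constant with h x v; trivial; [lra|].
    intros s hs; apply hv; lra.
  - intros x hx IH.
    destruct (hf x eps heps) as [_ (v & d & hd & hv)].
    set (z := Rmax a (x - d / 2)).
    assert (a <= z)%R by apply Rmax_l.
    assert (x - d / 2 <= z)%R by apply Rmax_r.
    assert (hz : (z < x)%R) by (apply Rmax_case; lra).
    destruct (IH z) as (h & h1 & h2); [lra|].
    apply extend_by_constant with h z v; trivial; [lra|].
    intros s hs; apply hv; lra.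
Qed.

Lemma regulated_ex_RInt (f : R -> R) (a b : R) (hf : regulated f) : ex_RInt f a b.
Proof.
  assert (Hle : forall a b, (a <= b)%R -> ex_RInt f a b).
  2:{ destruct (Rle_lt_dec a b); [auto|]. apply ex_RInt_swap, Hle; lra. }
  clear a b; intros a b hab.
  assert (Hn : forall n : nat, exists h, ex_RInt h a b /\
     forall s, (Rabs (f s - h s) <= / (INR n + 1))%R).
  { intros n. assert (hn := RinvN_pos n).
    destruct (regulated_approximation f a b (/ (INR n + 1)) hf hab hn) as (h & h1 & h2).
    (* Outside [a, b] the approximant is f itself: the convergence has to be
       uniform on the whole line. *)
    exists (fun s => if Rle_dec a s then if Rle_dec s b then h s else f s else f s).
    split.
    - apply ex_RInt_ext with h; trivial.
      intros s. rewrite Rmin_left, Rmax_right by lra. intros hs.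
      destruct (Rle_dec a s); [|lra]. destruct (Rle_dec s b); [trivial|lra].
    - intros s. destruct (Rle_dec a s), (Rle_dec s b);
        (apply h2; lra) || (rewrite Rminus_diag, Rabs_R0; lra). }
  destruct (choice _ Hn) as [h hh].
  destruct (filterlim_RInt (V := R_CompleteNormedModule) h a b eventually _ f
              (fun n => RInt (h n) a b)) as (I & _ & hI).
  - intros n. apply (RInt_correct (V := R_CompleteNormedModule)), hh.
  - apply filterlim_locally. intros eps.
    destruct (cv_infty_cv_0 (fun n => INR n + 1)%R) with (eps := pos eps) as [N HN].
    + intros M. destruct (INR_unbounded M) as [N HN]. exists N. intros n hn.
      apply le_INR in hn. lra.
    + apply cond_pos.
    + exists N. intros n hn s.
      specialize (HN n hn). unfold Rdist in HN. rewrite Rminus_0_r in HN.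
      apply Rle_lt_trans with (2 := Rle_lt_trans _ _ _ (Rle_abs _) HN).
      rewrite <- Rabs_Ropp.
      change (Rabs (- (h n s - f s)) <= / (INR n + 1))%R.
      replace (- (h n s - f s))%R with (f s - h n s)%R by ring. apply hh.
  - now exists I.
Qed.

(** The inequality is the mean value bound for the integral of [f].  It is all
    that is used of the primitive: it gives its increments exactly where [f] is
    constant, its derivative where [f] is continuous, and its
    continuity from the one-sided bounds of [f]. *)
Lemma regulated_antiderivative (f : R -> R) (hf : regulated f) :
  exists F : R -> R, forall a b v eps, (a <= b)%R ->
    (forall s, (a < s < b)%R -> (Rabs (f s - v) <= eps)%R) ->
    (Rabs (F b - F a - v * (b - a)) <= eps * (b - a))%R.
Proof.
  exists (fun x => RInt f 0 x). intros a b v eps hab hv.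
  assert (hint := regulated_ex_RInt f).
  assert (E1 : (RInt f 0 b - RInt f 0 a = RInt f a b)%R).
  { rewrite <- (RInt_Chasles (V := R_CompleteNormedModule) f 0 a b) by auto.
    unfold plus; simpl. ring. }
  rewrite E1.
  assert (K1 : ((v - eps) * (b - a) <= RInt f a b)%R).
  { replace ((v - eps) * (b - a))%R with (RInt (fun _ => v - eps)%R a b).
    - apply RInt_le; auto; [apply ex_RInt_const|].
      intros s hs. specialize (hv s hs). apply Rabs_le_between in hv. lra.
    - rewrite RInt_const. unfold scal; simpl; unfold mult; simpl. ring. }
  assert (K2 : (RInt f a b <= (v + eps) * (b - a))%R).
  { replace ((v + eps) * (b - a))%R with (RInt (fun _ => v + eps)%R a b).
    - apply RInt_le; auto; [apply ex_RInt_const|].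
      intros s hs. specialize (hv s hs). apply Rabs_le_between in hv. lra.
    - rewrite RInt_const. unfold scal; simpl; unfold mult; simpl. ring. }
  apply Rabs_le. lra.
Qed.

Definition Cregulated (g : R -> C) : Prop :=
  forall x eps, (0 < eps)%R ->
    (exists v delta, (0 < delta)%R /\
       forall s, (x < s < x + delta)%R -> (Cmod (g s - v) <= eps)%R) /\
    (exists v delta, (0 < delta)%R /\
       forall s, (x - delta < s < x)%R -> (Cmod (g s - v) <= eps)%R).

(** The factor 2 comes from adding the bounds of the real and imaginary parts. *)
Lemma Cregulated_antiderivative (g : R -> C) (hg : Cregulated g) :
  exists F : R -> C, forall a b v eps, (a <= b)%R ->
    (forall s, (a < s < b)%R -> (Cmod (g s - v) <= eps)%R) ->
    (Cmod (F b - F a - v * RtoC (b - a)%R) <= 2 * (eps * (b - a)))%R.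
Proof.
  destruct (regulated_antiderivative (fun s => fst (g s))) as [F1 H1].
  { intros x eps heps. destruct (hg x eps heps) as [(v & d & hd & hv) (w & e & he & hw)].
    split.
    - exists (fst v), d; split; trivial. intros s hs.
      eapply Rle_trans; [apply (Cmod_fst (g s - v))|auto].
    - exists (fst w), e; split; trivial. intros s hs.
      eapply Rle_trans; [apply (Cmod_fst (g s - w))|auto]. }
  destruct (regulated_antiderivative (fun s => snd (g s))) as [F2 H2].
  { intros x eps heps. destruct (hg x eps heps) as [(v & d & hd & hv) (w & e & he & hw)].
    split.
    - exists (snd v), d; split; trivial. intros s hs.
      eapply Rle_trans; [apply (Cmod_snd (g s - v))|auto].
    - exists (snd w), e; split; trivial. intros s hs.
      eapply Rle_trans; [apply (Cmod_snd (g s - w))|auto]. }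
  exists (fun x => (F1 x, F2 x)). intros a b v eps hab hv.
  specialize (H1 a b (fst v) eps hab). specialize (H2 a b (snd v) eps hab).
  eapply Rle_trans; [apply Cmod_le_components|]. simpl.
  replace (F1 b + - F1 a + - (fst v * (b - a) - snd v * 0))%R
    with (F1 b - F1 a - fst v * (b - a))%R by ring.
  replace (F2 b + - F2 a + - (fst v * 0 + snd v * (b - a)))%R
    with (F2 b - F2 a - snd v * (b - a))%R by ring.
  assert (K1 := H1 (fun s hs => Rle_trans _ _ _ (Cmod_fst (g s - v)) (hv s hs))).
  assert (K2 := H2 (fun s hs => Rle_trans _ _ _ (Cmod_snd (g s - v)) (hv s hs))).
  lra.
Qed.

(** * Jumps, gaps and graininess of a time scale *)

Lemma closed_adherent (T : R -> Prop) (hT : closed T) (x : R)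
  (hx : forall delta, (0 < delta)%R -> exists s, T s /\ (Rabs (s - x) < delta)%R) : T x.
Proof.
  apply hT. intros [d hd]. destruct (hx d (cond_pos d)) as (s & hs & hsx).
  exact (hd s hsx hs).
Qed.

Lemma Lub_Rbar_attained (D : R -> Prop) (hD : closed D) (r M : R) (hr : D r)
  (hM : forall s, D s -> (s <= M)%R) :
  D (real (Lub_Rbar D)) /\ forall s, D s -> (s <= real (Lub_Rbar D))%R.
Proof.
  destruct (Lub_Rbar_correct D) as [h1 h2].
  assert (h3 := h1 r hr). assert (h4 := h2 (Finite M) hM).
  destruct (Lub_Rbar D) as [u| |]; simpl in *; try contradiction.
  split; [|exact h1].
  apply closed_adherent; trivial. intros d hd.
  apply NNPP; intros hn.
  assert (h := h2 (Finite (u - d))). simpl in h.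
  assert (u <= u - d)%R; [|lra]. apply h. intros s hs; simpl.
  assert (hu := h1 s hs). simpl in hu.
  destruct (Rle_lt_dec s (u - d)); trivial. exfalso; apply hn.
  exists s; split; trivial. apply Rabs_lt_between; lra.
Qed.

Lemma sigma_le (T : R -> Prop) (t s : R) (hs : T s) (hts : (t < s)%R) :
  (sigma T t <= s)%R.
Proof.
  unfold sigma. destruct excluded_middle_informative as [_|n]; [|exfalso; apply n; now exists s].
  destruct (Glb_Rbar_correct (fun s => T s /\ (t < s)%R)) as [h1 h2].
  assert (h3 := h1 s (conj hs hts)).
  assert (h4 := h2 (Finite t) (fun r hr => Rlt_le _ _ (proj2 hr))).
  destruct Glb_Rbar; simpl in *; trivial; contradiction.
Qed.

Lemma sigma_greatest (T : R -> Prop) (t s m : R) (hs : T s) (hts : (t < s)%R)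
  (hm : forall r, T r -> (t < r)%R -> (m <= r)%R) : (m <= sigma T t)%R.
Proof.
  unfold sigma. destruct excluded_middle_informative as [_|n]; [|exfalso; apply n; now exists s].
  destruct (Glb_Rbar_correct (fun s => T s /\ (t < s)%R)) as [h1 h2].
  assert (h3 := h1 s (conj hs hts)).
  assert (h4 := h2 (Finite m) (fun r hr => hm r (proj1 hr) (proj2 hr))).
  destruct Glb_Rbar; simpl in *; trivial; contradiction.
Qed.

Lemma sigma_maximum (T : R -> Prop) (t : R) (ht : T t)
  (hmax : forall s, T s -> (s <= t)%R) : sigma T t = t.
Proof.
  unfold sigma. destruct excluded_middle_informative as [(s & hs & hts)|_].
  { specialize (hmax s hs); lra. }
  rewrite (is_lub_Rbar_unique T (Finite t)); trivial.
  split; [exact hmax|]. intros b hb. now apply hb.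
Qed.

Lemma sigma_ge (T : R -> Prop) (t : R) (ht : T t) : (t <= sigma T t)%R.
Proof.
  destruct (classic (exists s, T s /\ (t < s)%R)) as [(s & hs & hts)|n].
  - apply sigma_greatest with s; trivial. intros; lra.
  - right; symmetry; apply sigma_maximum; trivial.
    intros s hs. apply Rnot_lt_le. intros h; apply n; now exists s.
Qed.

Lemma right_dense_accumulation (T : R -> Prop) (t s delta : R) (ht : T t)
  (hd : right_dense T t) (hs : T s) (hts : (t < s)%R) (hdelta : (0 < delta)%R) :
  exists r, T r /\ (t < r < t + delta)%R.
Proof.
  apply NNPP; intros n. unfold right_dense in hd.
  assert (t + delta <= sigma T t)%R; [|lra].
  apply sigma_greatest with s; trivial. intros r hr htr.
  apply Rnot_lt_le; intros h; apply n; exists r; split; [trivial|lra].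
Qed.

Lemma sigma_unique (T : R -> Prop) (t u : R) (hu : T u) (htu : (t < u)%R)
  (hgap : forall s, T s -> (t < s)%R -> (u <= s)%R) : sigma T t = u.
Proof.
  apply Rle_antisym; [now apply sigma_le|now apply sigma_greatest with u].
Qed.

Lemma rho_bounds (T : R -> Prop) (t : R) (ht : T t) :
  (rho T t <= t)%R /\ forall s, T s -> (s < t)%R -> (s <= rho T t)%R.
Proof.
  unfold rho. destruct excluded_middle_informative as [(s & hs & hst)|n].
  - destruct (Lub_Rbar_correct (fun s => T s /\ (s < t)%R)) as [h1 h2].
    assert (h3 := h1 s (conj hs hst)).
    assert (h4 := h2 (Finite t) (fun r hr => Rlt_le _ _ (proj2 hr))).
    destruct Lub_Rbar as [u| |]; simpl in *; try contradiction.
    split; trivial. intros r hr hrt. exact (h1 r (conj hr hrt)).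
  - split.
    + rewrite (is_glb_Rbar_unique T (Finite t)); [apply Rle_refl|].
      split; [|intros b hb; now apply hb].
      intros s hs. apply Rnot_lt_le. intros h; apply n; now exists s.
    + intros s hs hst. exfalso; apply n; now exists s.
Qed.

Lemma left_accumulation_dense (T : R -> Prop) (t : R) (ht : T t)
  (h : forall delta, (0 < delta)%R -> exists s, T s /\ (t - delta < s < t)%R) :
  left_dense T t.
Proof.
  destruct (rho_bounds T t ht) as [h1 h2]. apply Rle_antisym; trivial.
  apply Rnot_lt_le; intros hlt.
  destruct (h (t - rho T t)%R) as (s & hs & hst); [lra|].
  assert (s <= rho T t)%R by (apply h2; trivial; lra). lra.
Qed.

(** The equation says nothing at such a point; continuity holds there because
    no other point of [T] is near. *)
Lemma not_Tkappa_isolated (T : R -> Prop) (t : R) (ht : T t) (h : ~ Tkappa T t) :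
  exists delta, (0 < delta)%R /\ forall s, T s -> (Rabs (s - t) < delta)%R -> s = t.
Proof.
  assert (hm : is_maximum T t /\ left_scattered T t).
  { apply NNPP; intros n; apply h; split; trivial. }
  destruct hm as [[_ hm] hl]. destruct (rho_bounds T t ht) as [h1 h2].
  exists (t - rho T t)%R; split; [unfold left_scattered in hl; lra|].
  intros s hs hst. apply Rabs_lt_between in hst. specialize (hm s hs).
  destruct (Rle_lt_or_eq_dec s t hm); trivial. specialize (h2 s hs ltac:(trivial)). lra.
Qed.

(** The last point of [T] up to [x]; composing with it extends a function from
    [T] to the gaps by the value at their left ends.  To the left of [T] it is the
    constant [0], so composites are locally constant there too. *)
Definition time_floor (T : R -> Prop) (x : R) : R :=
  real (Lub_Rbar (fun s => T s /\ (s <= x)%R)).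

Lemma time_floor_spec (T : R -> Prop) (hT : closed T) (r x : R) (hr : T r) (hrx : (r <= x)%R) :
  T (time_floor T x) /\ (time_floor T x <= x)%R /\
  forall s, T s -> (s <= x)%R -> (s <= time_floor T x)%R.
Proof.
  destruct (Lub_Rbar_attained (fun s => T s /\ (s <= x)%R)) with r x as [[h1 h2] h3].
  - apply closed_and; trivial. apply closed_le.
  - now split.
  - now intros s [_ hs].
  - repeat split; trivial. intros s hs hsx; now apply h3.
Qed.

Lemma time_floor_gap (T : R -> Prop) (x y : R) (hxy : (x <= y)%R)
  (hgap : forall s, T s -> (s <= y)%R -> (s <= x)%R) : time_floor T y = time_floor T x.
Proof.
  unfold time_floor. f_equal. apply Lub_Rbar_eqset. intros s; split; intros [h1 h2]; split; auto.
  lra.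
Qed.

Lemma time_floor_in (T : R -> Prop) (hT : closed T) (t : R) (ht : T t) : time_floor T t = t.
Proof.
  destruct (time_floor_spec T hT t t ht (Rle_refl t)) as (_ & h1 & h2).
  apply Rle_antisym; auto using Rle_refl.
Qed.

(** The left step of an induction on a time scale: a point is either approached
    from the left or reached by a jump. *)
Lemma left_dense_or_jump (T : R -> Prop) (hT : closed T) (r t : R) (ht : T t)
  (hr : T r) (hrt : (r < t)%R) :
  (forall delta, (0 < delta)%R -> exists s, T s /\ (t - delta < s < t)%R) \/
  exists s, T s /\ (r <= s < t)%R /\ sigma T s = t.
Proof.
  destruct (classic (forall delta, (0 < delta)%R -> exists s, T s /\ (t - delta < s < t)%R))
    as [h|h]; [now left|right].
  apply not_all_ex_not in h as [d h]. apply imply_to_and in h as [hd h].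
  assert (hgap : forall s, T s -> (s < t)%R -> (s <= t - d)%R).
  { intros s hs hst. apply Rnot_lt_le; intros h'; apply h; exists s; split; trivial. lra. }
  destruct (time_floor_spec T hT r (t - d) hr (hgap r hr hrt)) as (h1 & h2 & h3).
  exists (time_floor T (t - d)). repeat split; trivial; [now apply h3, hgap|lra|].
  apply sigma_unique; trivial; [lra|]. intros s hs hs'.
  apply Rnot_lt_le; intros hst. specialize (h3 s hs (hgap s hs hst)). lra.
Qed.

Definition limit_within (D : R -> Prop) (f : R -> C) (t : R) (l : C) : Prop :=
  forall eps, (0 < eps)%R -> exists delta, (0 < delta)%R /\
    forall s, D s -> (Rabs (s - t) < delta)%R -> (Cmod (f s - l) < eps)%R.

(** The uniform structure of [C] is that of a product; its balls and those of
    [Cmod] contain each other up to the factor [sqrt 2]. *)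
Lemma filterlim_limit_within (D : R -> Prop) (f : R -> C) (t : R) (l : C) :
  filterlim f (within D (locally t)) (locally l) <-> limit_within D f t l.
Proof.
  split.
  - intros h eps heps.
    assert (hs : (0 < sqrt 2)%R) by (apply sqrt_lt_R0; lra).
    assert (he : (0 < eps / sqrt 2)%R) by now apply Rdiv_lt_0_compat.
    destruct (proj1 (filterlim_locally _ _) h (mkposreal _ he)) as [d hd].
    exists d; split; [apply cond_pos|]. intros s hD hst.
    assert (hb := C_NormedModule_mixin_compat2 _ _ _ (hd s hst hD)).
    simpl in hb. replace (sqrt 2 * (eps / sqrt 2))%R with eps in hb by (field; lra).
    exact hb.
  - intros h. apply filterlim_locally. intros eps.
    destruct (h eps (cond_pos eps)) as (d & hd & H).
    exists (mkposreal d hd). intros s hst hD.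
    apply C_NormedModule_mixin_compat1. exact (H s hD hst).
Qed.

Lemma graininess_ge_0 (T : R -> Prop) (t : R) (ht : T t) : (0 <= graininess T t)%R.
Proof. assert (h := sigma_ge T t ht). unfold graininess; lra. Qed.

(** A jump starting to the left of [t] cannot go beyond [t]. *)
Lemma graininess_left_limit (T : R -> Prop) (t eps : R) (ht : T t) :
  forall s, T s -> (s < t)%R -> (Rabs (s - t) < eps)%R -> (graininess T s < eps)%R.
Proof.
  intros s hs hst h. apply Rabs_lt_between in h.
  assert (hle := sigma_le T s t ht hst). unfold graininess; lra.
Qed.

(** To the right of a right-dense [t] that is not the maximum, jumps starting
    before a point [u] of [T] cannot go beyond [u], and [u] can be taken close
    to [t]. *)
Lemma graininess_right_dense_limit (T : R -> Prop) (t eps : R) (ht : T t)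
  (hd : right_dense T t) (heps : (0 < eps)%R) :
  exists delta, (0 < delta)%R /\
    forall s, T s -> (Rabs (s - t) < delta)%R -> (graininess T s < eps)%R.
Proof.
  assert (H0 : (graininess T t < eps)%R).
  { unfold graininess. unfold right_dense in hd. lra. }
  destruct (classic (exists s, T s /\ (t < s)%R)) as [(r & hr & htr)|n].
  - destruct (right_dense_accumulation T t r eps ht hd hr htr heps) as (u & hu & htu).
    exists (Rmin eps (u - t)). split; [apply Rmin_case; lra|].
    intros s hs hst. assert (h1 := Rmin_l eps (u - t)). assert (h2 := Rmin_r eps (u - t)).
    destruct (total_order_T s t) as [[h| ->]|h]; trivial.
    + apply graininess_left_limit with t; trivial; lra.
    + apply Rabs_lt_between in hst.
      assert (hle := sigma_le T s u hu ltac:(lra)). unfold graininess; lra.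
  - exists eps; split; trivial. intros s hs hst.
    destruct (total_order_T s t) as [[h| ->]|h]; trivial.
    + now apply graininess_left_limit with t.
    + exfalso; apply n; now exists s.
Qed.

(** Hilger's cylinder transformation, with the Cayley transform in place of
    [1 + z]: the logarithmic delta derivative that the Cayley-exponential must
    have when [Lambda] is a logarithm of [cayley]. *)
Definition cylinder (Lambda : C -> C) (T : R -> Prop) (alpha : R -> C) (t : R) : C :=
  if Req_dec_T (graininess T t) 0 then alpha t
  else Lambda (alpha t * graininess T t) / graininess T t.

(** Where [alpha] is bounded and [mu] is small, [Lambda (alpha mu) / mu] differs
    from [alpha] by a small multiple of [Cmod alpha]. *)
Lemma cylinder_limit (Lambda : C -> C) (T : R -> Prop) (alpha : R -> C)
  (hLambda : forall eps, (0 < eps)%R -> exists delta, (0 < delta)%R /\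
     forall w : C, (Cmod w < delta)%R -> (Cmod (Lambda w - w) <= eps * Cmod w)%R)
  (D : R -> Prop) (t : R) (l : C) (hD : forall s, D s -> T s)
  (hmu : forall eps, (0 < eps)%R -> exists delta, (0 < delta)%R /\
     forall s, D s -> (Rabs (s - t) < delta)%R -> (graininess T s < eps)%R)
  (halpha : limit_within D alpha t l) :
  limit_within D (cylinder Lambda T alpha) t l.
Proof.
  intros eps heps.
  set (M := (Cmod l + 1)%R). assert (hM : (0 < M)%R) by (assert (h := Cmod_ge_0 l); unfold M; lra).
  assert (he : (0 < eps / (2 * M))%R) by (apply Rdiv_lt_0_compat; lra).
  destruct (hLambda _ he) as (d & hd & H).
  assert (hdM : (0 < d / M)%R) by (apply Rdiv_lt_0_compat; lra).
  destruct (hmu _ hdM) as (d1 & hd1 & H1).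
  destruct (halpha 1%R Rlt_0_1) as (d2 & hd2 & H2).
  destruct (halpha (eps / 2)%R ltac:(lra)) as (d3 & hd3 & H3).
  exists (Rmin d1 (Rmin d2 d3)). split; [repeat apply Rmin_case; trivial|].
  intros s hs hst.
  assert (k1 := Rmin_l d1 (Rmin d2 d3)). assert (k2 := Rmin_r d1 (Rmin d2 d3)).
  assert (k3 := Rmin_l d2 d3). assert (k4 := Rmin_r d2 d3).
  specialize (H1 s hs ltac:(lra)). specialize (H2 s hs ltac:(lra)).
  specialize (H3 s hs ltac:(lra)).
  assert (hb : (Cmod (alpha s) <= M)%R).
  { replace (alpha s) with ((alpha s - l) + l) by ring.
    eapply Rle_trans; [apply Cmod_triangle|]. unfold M; lra. }
  unfold cylinder. destruct (Req_dec_T (graininess T s) 0) as [e|ne]; [lra|].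
  assert (hg := graininess_ge_0 T s (hD s hs)). set (m := graininess T s) in *.
  assert (hm : (0 < m)%R) by lra.
  assert (hmC : RtoC m <> 0) by (intros q; injection q; lra).
  assert (hw : (Cmod (alpha s * m) <= M * m)%R).
  { rewrite Cmod_mult, Cmod_R, (Rabs_right m) by lra. apply Rmult_le_compat_r; lra. }
  assert (hwd : (Cmod (alpha s * m) < d)%R).
  { apply Rle_lt_trans with (1 := hw).
    replace d with (M * (d / M))%R by (field; lra). now apply Rmult_lt_compat_l. }
  specialize (H _ hwd).
  replace (Lambda (alpha s * m) / m - l)
    with ((Lambda (alpha s * m) - alpha s * m) / m + (alpha s - l)) by (field; trivial).
  eapply Rle_lt_trans; [apply Cmod_triangle|].
  rewrite Cmod_div, Cmod_R, (Rabs_right m) by (trivial || lra).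
  assert ((Cmod (Lambda (alpha s * m)%C - alpha s * m) / m <= eps / 2)%R); [|lra].
  apply Rmult_le_reg_r with m; trivial. unfold Rdiv at 1.
  rewrite Rmult_assoc, Rinv_l, Rmult_1_r by lra.
  apply Rle_trans with (1 := H).
  replace (eps / 2 * m)%R with (eps / (2 * M) * (M * m))%R by (field; lra).
  apply Rmult_le_compat_l; lra.
Qed.

(** * Calculus of the delta derivative *)

(** Hilger's form of the delta derivative.  Without the quotient, the point
    [s = sigma t] is no exception, and right-dense and right-scattered points can
    be treated by the same estimates. *)
Lemma delta_derive_iff (T : R -> Prop) (f : R -> C) (t : R) (l : C) :
  is_delta_derive T f t l <->
  forall eps, (0 < eps)%R -> exists delta, (0 < delta)%R /\
    forall s, T s -> (Rabs (s - t) < delta)%R ->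
      (Cmod (f (sigma T t) - f s - l * RtoC (sigma T t - s)%R)
         <= eps * Rabs (sigma T t - s))%R.
Proof.
  assert (hq : forall s : R, s <> sigma T t ->
    (Cmod (f (sigma T t) - f s - l * RtoC (sigma T t - s)%R) =
     Cmod ((f (sigma T t) - f s) / RtoC (sigma T t - s)%R - l) * Rabs (sigma T t - s))%R).
  { intros s hs. rewrite <- Cmod_R, <- Cmod_mult. f_equal. field.
    intros q; injection q; lra. }
  unfold is_delta_derive. rewrite filterlim_limit_within. split.
  - intros h eps heps. destruct (h eps heps) as (d & hd & H). exists d; split; trivial.
    intros s hs hst. destruct (Req_dec s (sigma T t)) as [->|ne].
    + rewrite Rminus_diag, Rabs_R0.
      replace (f (sigma T t) - f (sigma T t) - l * 0) with (RtoC 0) by ring.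
      rewrite Cmod_0; lra.
    + rewrite hq by trivial. apply Rmult_le_compat_r; [apply Rabs_pos|].
      now apply Rlt_le, H.
  - intros h eps heps. destruct (h (eps / 2)%R ltac:(lra)) as (d & hd & H).
    exists d; split; trivial. intros s [hs ne] hst.
    specialize (H s hs hst). rewrite hq in H by trivial.
    apply Rmult_le_reg_r in H; [lra|]. apply Rabs_pos_lt; lra.
Qed.

Lemma delta_derive_ext (T : R -> Prop) (f g : R -> C) (t : R) (l l' : C)
  (hfg : forall s, f s = g s) (hl : l = l') :
  is_delta_derive T f t l -> is_delta_derive T g t l'.
Proof.
  subst l'. rewrite !delta_derive_iff. intros h eps heps.
  destruct (h eps heps) as (d & hd & H). exists d; split; trivial.
  intros s hs hst. rewrite <- !hfg. now apply H.
Qed.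

(** The point [s = t] itself enters the limit, so the error at it is smaller
    than every positive number. *)
Lemma delta_derive_jump (T : R -> Prop) (f : R -> C) (t : R) (l : C) (ht : T t)
  (hf : is_delta_derive T f t l) : f (sigma T t) = f t + l * graininess T t.
Proof.
  rewrite delta_derive_iff in hf.
  assert (hz : (Cmod (f (sigma T t) - f t - l * graininess T t) <= 0)%R).
  { apply le_epsilon. intros e he. rewrite Rplus_0_l.
    set (m := Rabs (sigma T t - t)). assert (hm : (0 <= m)%R) by apply Rabs_pos.
    destruct (hf (e / (m + 1))%R) as (d & hd & H); [apply Rdiv_lt_0_compat; lra|].
    eapply Rle_trans; [apply (H t ht)|].
    - rewrite Rminus_diag, Rabs_R0; lra.
    - fold m. replace e with (e / (m + 1) * (m + 1))%R at 2 by (field; lra).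
      apply Rmult_le_compat_l; [apply Rlt_le, Rdiv_lt_0_compat|]; lra. }
  assert (h0 := Cmod_ge_0 (f (sigma T t) - f t - l * graininess T t)).
  assert (e := Cmod_eq_0 _ (Rle_antisym _ _ hz h0)).
  replace (f (sigma T t)) with
    ((f (sigma T t) - f t - l * graininess T t) + (f t + l * graininess T t)) by ring.
  rewrite e; ring.
Qed.

Lemma delta_derive_continuous (T : R -> Prop) (f : R -> C) (t : R) (l : C) (ht : T t)
  (hf : is_delta_derive T f t l) : limit_within T f t (f t).
Proof.
  assert (hj := delta_derive_jump T f t l ht hf).
  rewrite delta_derive_iff in hf. intros eps heps.
  assert (hg := graininess_ge_0 T t ht).
  unfold graininess in *. set (u := sigma T t) in *.
  assert (hl := Cmod_ge_0 l).
  set (K := (u - t + 1)%R). assert (hK : (0 < K)%R) by (unfold K; lra).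
  destruct (hf (eps / (2 * K))%R) as (d & hd & H); [apply Rdiv_lt_0_compat; lra|].
  set (e := (eps / (2 * (Cmod l + 1)))%R).
  assert (he : (0 < e)%R) by (apply Rdiv_lt_0_compat; lra).
  exists (Rmin d (Rmin 1 e)). split; [repeat apply Rmin_case; lra|].
  intros s hs hst.
  assert (k1 := Rmin_l d (Rmin 1 e)). assert (k2 := Rmin_r d (Rmin 1 e)).
  assert (k3 := Rmin_l 1 e). assert (k4 := Rmin_r 1 e).
  specialize (H s hs ltac:(lra)).
  replace (f s - f t) with
    (- (f u - f s - l * RtoC (u - s)%R) + l * RtoC (s - t)%R).
  2:{ rewrite hj. rewrite !RtoC_minus. ring. }
  eapply Rle_lt_trans; [apply Cmod_triangle|]. rewrite Cmod_opp, Cmod_mult, Cmod_R.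
  assert (hus : (Rabs (u - s) <= K)%R).
  { apply Rabs_le_between. assert (hst' : (Rabs (s - t) < 1)%R) by lra.
    apply Rabs_lt_between in hst'. unfold K; lra. }
  assert (h1 : (eps / (2 * K) * Rabs (u - s) <= eps / 2)%R).
  { replace (eps / 2)%R with (eps / (2 * K) * K)%R by (field; lra).
    apply Rmult_le_compat_l; [apply Rlt_le, Rdiv_lt_0_compat|]; lra. }
  assert (h2 : (Cmod l * Rabs (s - t) < eps / 2)%R).
  { replace (eps / 2)%R with ((Cmod l + 1) * e)%R by (unfold e; field; lra).
    assert (h := Rabs_pos (s - t)). nra. }
  lra.
Qed.

Lemma delta_derive_right_scattered (T : R -> Prop) (f : R -> C) (t : R) (l : C) (ht : T t)
  (hs : (t < sigma T t)%R) (hc : limit_within T f t (f t))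
  (hj : f (sigma T t) = f t + l * graininess T t) : is_delta_derive T f t l.
Proof.
  apply delta_derive_iff. intros eps heps. unfold graininess in hj.
  set (u := sigma T t) in *. set (m := (u - t)%R) in *.
  assert (hm : (0 < m)%R) by (unfold m; lra).
  assert (hl := Cmod_ge_0 l).
  assert (hem : (0 < eps * m / 4)%R) by (assert (0 < eps * m)%R by (apply Rmult_lt_0_compat; lra); lra).
  destruct (hc (eps * m / 4)%R) as (d & hd & H); trivial.
  set (e := (eps * m / 4 / (Cmod l + 1))%R).
  assert (he : (0 < e)%R) by (apply Rdiv_lt_0_compat; lra).
  exists (Rmin d (Rmin (m / 2) e)). split; [repeat apply Rmin_case; lra|].
  intros s hTs hst.
  assert (k1 := Rmin_l d (Rmin (m / 2) e)). assert (k2 := Rmin_r d (Rmin (m / 2) e)).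
  assert (k3 := Rmin_l (m / 2) e). assert (k4 := Rmin_r (m / 2) e).
  specialize (H s hTs ltac:(lra)).
  replace (f u - f s - l * RtoC (u - s)%R) with (- (f s - f t) + l * RtoC (s - t)%R).
  2:{ rewrite hj. unfold m. rewrite !RtoC_minus. ring. }
  eapply Rle_trans; [apply Cmod_triangle|]. rewrite Cmod_opp, Cmod_mult, Cmod_R.
  assert (h2 : (Cmod l * Rabs (s - t) <= eps * m / 4)%R).
  { replace (eps * m / 4)%R with ((Cmod l + 1) * e)%R by (unfold e; field; lra).
    assert (h := Rabs_pos (s - t)). nra. }
  assert (hus : (m / 2 <= Rabs (u - s))%R).
  { assert (hst' : (Rabs (s - t) < m / 2)%R) by lra. apply Rabs_lt_between in hst'.
    rewrite Rabs_right; unfold m in *; lra. }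
  assert (eps * (m / 2) <= eps * Rabs (u - s))%R by (apply Rmult_le_compat_l; lra).
  lra.
Qed.

Lemma delta_derive_linear (T : R -> Prop) (f g : R -> C) (t : R) (a b lf lg : C)
  (hf : is_delta_derive T f t lf) (hg : is_delta_derive T g t lg) :
  is_delta_derive T (fun s => a * f s + b * g s) t (a * lf + b * lg).
Proof.
  rewrite delta_derive_iff in *. intros eps heps.
  assert (ha := Cmod_ge_0 a). assert (hb := Cmod_ge_0 b).
  set (e := (eps / (Cmod a + Cmod b + 1))%R).
  assert (he : (0 < e)%R) by (apply Rdiv_lt_0_compat; lra).
  destruct (hf e he) as (d1 & hd1 & H1). destruct (hg e he) as (d2 & hd2 & H2).
  exists (Rmin d1 d2). split; [apply Rmin_case; lra|].
  intros s hs hst. assert (k1 := Rmin_l d1 d2). assert (k2 := Rmin_r d1 d2).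
  specialize (H1 s hs ltac:(lra)). specialize (H2 s hs ltac:(lra)).
  set (u := sigma T t) in *. set (r := Rabs (u - s)) in *.
  assert (hr : (0 <= r)%R) by apply Rabs_pos.
  match goal with |- (Cmod ?z <= _)%R => replace z with
    (a * (f u - f s - lf * RtoC (u - s)%R) + b * (g u - g s - lg * RtoC (u - s)%R)) by ring end.
  eapply Rle_trans; [apply Cmod_triangle|]. rewrite !Cmod_mult.
  replace eps with ((Cmod a + Cmod b + 1) * e)%R by (unfold e; field; lra).
  assert (Cmod a * Cmod (f u - f s - lf * RtoC (u - s)%R)%C <= Cmod a * (e * r))%R
    by now apply Rmult_le_compat_l.
  assert (Cmod b * Cmod (g u - g s - lg * RtoC (u - s)%R)%C <= Cmod b * (e * r))%R
    by now apply Rmult_le_compat_l.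
  assert (0 <= e * r)%R by (apply Rmult_le_pos; lra). lra.
Qed.

(** The asymmetric rule [f^Delta g(sigma) + f(t) g^Delta] is what the estimate
    gives; it equals the symmetric one because both increments over the gap are
    the graininess times the derivative. *)
Lemma delta_derive_mult (T : R -> Prop) (f g : R -> C) (t : R) (lf lg : C) (ht : T t)
  (hf : is_delta_derive T f t lf) (hg : is_delta_derive T g t lg) :
  is_delta_derive T (fun s => f s * g s) t (lf * mean T g t + mean T f t * lg).
Proof.
  assert (jf := delta_derive_jump T f t lf ht hf).
  assert (jg := delta_derive_jump T g t lg ht hg).
  assert (cf := delta_derive_continuous T f t lf ht hf).
  assert (hl : lf * g (sigma T t) + f t * lg = lf * mean T g t + mean T f t * lg).
  { unfold mean. rewrite jf, jg. field. }
  apply (delta_derive_ext T (fun s => f s * g s) _ t _ _ (fun s => eq_refl) hl).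
  rewrite delta_derive_iff in *. intros eps heps.
  set (u := sigma T t) in *.
  set (K := (Cmod (g u) + Cmod (f t) + Cmod lg + 2)%R).
  assert (h1 := Cmod_ge_0 (g u)). assert (h2 := Cmod_ge_0 (f t)). assert (h3 := Cmod_ge_0 lg).
  assert (hK : (0 < K)%R) by (unfold K; lra).
  set (e := (eps / K)%R). assert (he : (0 < e)%R) by (apply Rdiv_lt_0_compat; lra).
  destruct (hf e he) as (d1 & hd1 & H1). destruct (hg e he) as (d2 & hd2 & H2).
  destruct (cf (Rmin 1 e)) as (d3 & hd3 & H3); [apply Rmin_case; lra|].
  exists (Rmin d1 (Rmin d2 d3)). split; [repeat apply Rmin_case; lra|].
  intros s hs hst.
  assert (k1 := Rmin_l d1 (Rmin d2 d3)). assert (k2 := Rmin_r d1 (Rmin d2 d3)).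
  assert (k3 := Rmin_l d2 d3). assert (k4 := Rmin_r d2 d3).
  assert (k5 := Rmin_l 1 e). assert (k6 := Rmin_r 1 e).
  specialize (H1 s hs ltac:(lra)). specialize (H2 s hs ltac:(lra)).
  specialize (H3 s hs ltac:(lra)).
  set (A := f u - f s - lf * RtoC (u - s)%R) in *.
  set (B := g u - g s - lg * RtoC (u - s)%R) in *.
  replace (f u * g u - f s * g s - (lf * g u + f t * lg) * RtoC (u - s)%R)
    with (A * g u + f s * B + (f s - f t) * lg * RtoC (u - s)%R) by (unfold A, B; ring).
  assert (hfs : (Cmod (f s) <= Cmod (f t) + 1)%R).
  { replace (f s) with ((f s - f t) + f t) by ring.
    eapply Rle_trans; [apply Cmod_triangle|]. lra. }
  eapply Rle_trans; [apply Cmod_triangle|].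
  eapply Rle_trans; [apply Rplus_le_compat_r, Cmod_triangle|].
  rewrite !Cmod_mult, Cmod_R. set (r := Rabs (u - s)) in *.
  assert (hr : (0 <= r)%R) by apply Rabs_pos.
  assert (her : (0 <= e * r)%R) by (apply Rmult_le_pos; lra).
  assert (M1 : (Cmod A * Cmod (g u) <= e * r * Cmod (g u))%R) by now apply Rmult_le_compat_r.
  assert (M2 : (Cmod (f s) * Cmod B <= (Cmod (f t) + 1) * (e * r))%R)
    by (apply Rmult_le_compat; trivial; apply Cmod_ge_0).
  assert (M3 : (Cmod (f s - f t) * Cmod lg * r <= e * Cmod lg * r)%R).
  { apply Rmult_le_compat_r; trivial. apply Rmult_le_compat_r; lra. }
  replace (eps * r)%R with (K * (e * r))%R by (unfold e; field; lra).
  unfold K. lra.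
Qed.

(** Along the induction the increment from [a] stays below [eps] times the
    length.  At a left-dense right-scattered point the derivative says nothing
    about the slope on the left, which is why the left step uses continuity, and
    the jump condition carries the bound over a gap. *)
Lemma zero_delta_derive_constant (T : R -> Prop) (hT : closed T) (p : R -> C)
  (hp : forall t, Tkappa T t -> is_delta_derive T p t 0) (a b : R) (ha : T a) (hb : T b)
  (hab : (a <= b)%R) : p b = p a.
Proof.
  assert (hcont : forall t, T t -> limit_within T p t (p t)).
  { intros t ht. destruct (classic (Tkappa T t)) as [hk|hk].
    - exact (delta_derive_continuous T p t 0 ht (hp t hk)).
    - intros e he. destruct (not_Tkappa_isolated T t ht hk) as (d & hd & H).
      exists d; split; trivial. intros s hs hst. rewrite (H s hs hst).
      replace (p t - p t) with (RtoC 0) by ring. now rewrite Cmod_0. }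
  assert (hkappa : forall t, T t -> (t < b)%R -> Tkappa T t).
  { intros t ht htb. split; trivial. intros [[_ hm] _]. specialize (hm b hb); lra. }
  assert (hslope : forall eps, (0 < eps)%R -> (Cmod (p b - p a) <= eps * (b - a))%R).
  { intros eps heps.
    apply (real_induction a b (fun x => T x -> (Cmod (p x - p a) <= eps * (x - a))%R)); trivial.
    4: lra.
    - intros _. replace (p a - p a) with (RtoC 0) by ring. rewrite Cmod_0; lra.
    - intros x hx hP. destruct (classic (T x)) as [hTx|hTx].
      + specialize (hP hTx). destruct (sigma_ge T x hTx) as [hlt|heq].
        * exists (sigma T x - x)%R; split; [lra|]. intros y hy _ hTy.
          assert (h := sigma_le T x y hTy ltac:(lra)). lra.
        * destruct (proj1 (delta_derive_iff _ _ _ _) (hp x (hkappa x hTx ltac:(lra))) eps heps)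
            as (d & hd & H).
          exists d; split; trivial. intros y hy _ hTy.
          specialize (H y hTy). rewrite <- heq in H.
          replace (p x - p y - 0 * RtoC (x - y)%R) with (- (p y - p x)) in H by ring.
          rewrite Cmod_opp, (Rabs_minus_sym x y), (Rabs_right (y - x)) in H by lra.
          specialize (H ltac:(lra)).
          replace (p y - p a) with ((p y - p x) + (p x - p a)) by ring.
          eapply Rle_trans; [apply Cmod_triangle|]. lra.
      + apply NNPP; intros n. apply hTx. apply closed_adherent; trivial.
        intros d hd. apply NNPP; intros n'. apply n. exists d; split; trivial.
        intros y hy _ hTy. exfalso; apply n'. exists y; split; trivial.
        apply Rabs_lt_between; lra.
    - intros x hx IH hTx.
      destruct (left_dense_or_jump T hT a x hTx ha) as [hd|(s & hs & hsx & hj)]; [lra| |].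
      + apply le_epsilon. intros e he. destruct (hcont x hTx e he) as (d & hd0 & H).
        destruct (hd (Rmin d (x - a))) as (s & hs & hsx); [apply Rmin_case; lra|].
        assert (k1 := Rmin_l d (x - a)). assert (k2 := Rmin_r d (x - a)).
        specialize (IH s ltac:(lra) hs).
        specialize (H s hs ltac:(apply Rabs_lt_between; lra)).
        replace (p x - p a) with (- (p s - p x) + (p s - p a)) by ring.
        eapply Rle_trans; [apply Cmod_triangle|]. rewrite Cmod_opp.
        assert (eps * (s - a) <= eps * (x - a))%R by (apply Rmult_le_compat_l; lra). lra.
      + assert (hks := hkappa s hs ltac:(lra)).
        assert (h := delta_derive_jump T p s 0 hs (hp s hks)). rewrite hj in h.
        specialize (IH s hsx hs). rewrite h. rewrite Cmult_0_l, Cplus_0_r.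
        assert (eps * (s - a) <= eps * (x - a))%R by (apply Rmult_le_compat_l; lra). lra. }
  assert (hz : (Cmod (p b - p a) <= 0)%R).
  { apply le_epsilon. intros e he. rewrite Rplus_0_l.
    eapply Rle_trans; [apply (hslope (e / (b - a + 1))%R), Rdiv_lt_0_compat; lra|].
    replace e with (e / (b - a + 1) * (b - a + 1))%R at 2 by (field; lra).
    apply Rmult_le_compat_l; [apply Rlt_le, Rdiv_lt_0_compat|]; lra. }
  assert (e := Cmod_eq_0 _ (Rle_antisym _ _ hz (Cmod_ge_0 _))).
  replace (p b) with ((p b - p a) + p a) by ring. rewrite e; ring.
Qed.

(** * Antiderivatives and the Cayley-exponential *)

(** Next to a one-sided accumulation point of [T] the floor tends to that point
    inside [T], and rd-continuity provides the limit; on the other sides the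
    floor is locally constant. *)
Lemma floor_regulated (T : R -> Prop) (hT : closed T) (b : R -> C) (hb : rd_continuous T b) :
  Cregulated (fun s => b (time_floor T s)).
Proof.
  intros x eps heps. split.
  - destruct (classic (exists d, (0 < d)%R /\ forall s, T s -> ~ (x < s < x + d)%R))
      as [(d & hd & H)|n].
    + exists (b (time_floor T x)), d. split; trivial. intros s hs.
      rewrite (time_floor_gap T x s).
      * replace (_ - _) with (RtoC 0) by ring. rewrite Cmod_0; lra.
      * lra.
      * intros r hr hrs. apply Rnot_lt_le; intros h. apply (H r hr); lra.
    + assert (hacc : forall d, (0 < d)%R -> exists s, T s /\ (x < s < x + d)%R).
      { intros d hd. apply NNPP; intros n'; apply n. exists d; split; trivial.
        intros s hs hx. apply n'; now exists s. }
      assert (hx : T x).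
      { apply closed_adherent; trivial. intros d hd. destruct (hacc d hd) as (s & hs & h).
        exists s; split; trivial. apply Rabs_lt_between; lra. }
      assert (hrd : right_dense T x).
      { apply Rle_antisym; [|now apply sigma_ge]. apply Rnot_lt_le; intros h.
        destruct (hacc (sigma T x - x)%R) as (s & hs & hs'); [lra|].
        assert (h' := sigma_le T x s hs ltac:(lra)). lra. }
      destruct (proj1 (filterlim_limit_within _ _ _ _) (proj1 (hb x hx) hrd) eps heps)
        as (d & hd & H).
      exists (b x), d. split; trivial. intros s hs.
      destruct (time_floor_spec T hT x s hx) as (h1 & h2 & h3); [lra|].
      specialize (h3 x hx ltac:(lra)).
      apply Rlt_le, H; trivial. apply Rabs_lt_between; lra.
  - destruct (classic (exists d, (0 < d)%R /\ forall s, T s -> ~ (x - d < s < x)%R))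
      as [(d & hd & H)|n].
    + exists (b (time_floor T (x - d))), d. split; trivial. intros s hs.
      rewrite (time_floor_gap T (x - d) s).
      * replace (_ - _) with (RtoC 0) by ring. rewrite Cmod_0; lra.
      * lra.
      * intros r hr hrs. apply Rnot_lt_le; intros h. apply (H r hr); lra.
    + assert (hacc : forall d, (0 < d)%R -> exists s, T s /\ (x - d < s < x)%R).
      { intros d hd. apply NNPP; intros n'; apply n. exists d; split; trivial.
        intros s hs hx. apply n'; now exists s. }
      assert (hx : T x).
      { apply closed_adherent; trivial. intros d hd. destruct (hacc d hd) as (s & hs & h).
        exists s; split; trivial. apply Rabs_lt_between; lra. }
      destruct (proj2 (hb x hx) (left_accumulation_dense T x hx hacc)) as [l hl].
      destruct (proj1 (filterlim_limit_within _ _ _ _) hl eps heps) as (d & hd & H).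
      destruct (hacc d hd) as (r & hr & hrx).
      exists l, (x - r)%R. split; [lra|]. intros s hs.
      destruct (time_floor_spec T hT r s hr) as (h1 & h2 & h3); [lra|].
      specialize (h3 r hr ltac:(lra)).
      apply Rlt_le, H; [split; trivial; lra|]. apply Rabs_lt_between; lra.
Qed.

(** [F] is a primitive of the extension of [b] to the gaps.  That extension
    need not be continuous at a right-dense left-scattered [t], but between [t]
    and a point [s] of [T] the floor stays between [t] and [s], so difference
    quotients taken inside [T] converge. *)
Lemma rd_continuous_antiderivative (T : R -> Prop) (hT : closed T) (b : R -> C)
  (hb : rd_continuous T b) :
  exists F : R -> C, forall t, T t -> is_delta_derive T F t (b t).
Proof.
  assert (hreg := floor_regulated T hT b hb).
  destruct (Cregulated_antiderivative _ hreg) as [F HF].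
  exists F. intros t ht.
  destruct (sigma_ge T t ht) as [hlt|heq].
  - assert (hleft : forall s, T s -> (Rabs (s - t) < sigma T t - t)%R -> (s <= t)%R).
    { intros s hs hst. apply Rabs_lt_between in hst. apply Rnot_lt_le; intros h.
      assert (h' := sigma_le T t s hs h). lra. }
    apply delta_derive_right_scattered; trivial.
    + intros eps heps.
      destruct (hreg t 1%R Rlt_0_1) as [_ (v & d & hd & H)].
      assert (hv := Cmod_ge_0 v).
      set (e := (eps / (Cmod v + 3))%R). assert (he : (0 < e)%R) by (apply Rdiv_lt_0_compat; lra).
      exists (Rmin (sigma T t - t) (Rmin d e)). split; [repeat apply Rmin_case; lra|].
      intros s hs hst.
      assert (k1 := Rmin_l (sigma T t - t) (Rmin d e)).
      assert (k2 := Rmin_r (sigma T t - t) (Rmin d e)).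
      assert (k3 := Rmin_l d e). assert (k4 := Rmin_r d e).
      specialize (hleft s hs ltac:(lra)).
      rewrite Rabs_minus_sym, Rabs_right in hst by lra.
      specialize (HF s t v 1%R hleft). rewrite Rmult_1_l in HF.
      specialize (HF (fun r hr => H r ltac:(lra))).
      replace (F s - F t) with (- ((F t - F s - v * RtoC (t - s)%R) + v * RtoC (t - s)%R)) by ring.
      rewrite Cmod_opp. eapply Rle_lt_trans; [apply Cmod_triangle|].
      rewrite Cmod_mult, Cmod_R, (Rabs_right (t - s)) by lra.
      replace eps with ((Cmod v + 3) * e)%R by (unfold e; field; lra). nra.
    + specialize (HF t (sigma T t) (b t) 0%R (Rlt_le _ _ hlt)).
      rewrite Rmult_0_l, Rmult_0_r in HF.
      assert (hz : (Cmod (F (sigma T t) - F t - b t * RtoC (sigma T t - t)%R) <= 0)%R).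
      { apply HF. intros s hs.
        rewrite (time_floor_gap T t s), time_floor_in; trivial.
        - replace (b t - b t) with (RtoC 0) by ring. rewrite Cmod_0; lra.
        - lra.
        - intros r hr hrs. apply Rnot_lt_le; intros h.
          assert (h' := sigma_le T t r hr h). lra. }
      assert (e := Cmod_eq_0 _ (Rle_antisym _ _ hz (Cmod_ge_0 _))).
      unfold graininess.
      replace (F (sigma T t)) with
        ((F (sigma T t) - F t - b t * RtoC (sigma T t - t)%R)
           + (F t + b t * RtoC (sigma T t - t)%R)) by ring.
      rewrite e; ring.
  - apply delta_derive_iff. intros eps heps.
    destruct (proj1 (filterlim_limit_within _ _ _ _) (proj1 (hb t ht) (eq_sym heq))
                (eps / 2)%R ltac:(lra)) as (d & hd & H).
    exists d; split; trivial. intros s hs hst. rewrite <- heq.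
    apply Rabs_lt_between in hst.
    destruct (Rle_lt_dec s t) as [hle|hgt].
    + rewrite (Rabs_right (t - s)) by lra.
      replace (eps * (t - s))%R with (2 * (eps / 2 * (t - s)))%R by field.
      apply HF; trivial. intros r hr.
      destruct (time_floor_spec T hT s r hs) as (h1 & h2 & h3); [lra|].
      specialize (h3 s hs ltac:(lra)).
      apply Rlt_le, H; trivial. apply Rabs_lt_between; lra.
    + rewrite Rabs_minus_sym, (Rabs_right (s - t)) by lra.
      replace (F t - F s - b t * RtoC (t - s)%R) with (- (F s - F t - b t * RtoC (s - t)%R)).
      2:{ rewrite !RtoC_minus; ring. }
      rewrite Cmod_opp.
      replace (eps * (s - t))%R with (2 * (eps / 2 * (s - t)))%R by field.
      apply HF; [lra|]. intros r hr.
      destruct (time_floor_spec T hT t r ht) as (h1 & h2 & h3); [lra|].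
      specialize (h3 t ht ltac:(lra)).
      apply Rlt_le, H; trivial. apply Rabs_lt_between; lra.
Qed.

Lemma cylinder_rd_continuous (Lambda : C -> C) (T : R -> Prop) (alpha : R -> C)
  (hLambda : forall eps, (0 < eps)%R -> exists delta, (0 < delta)%R /\
     forall w : C, (Cmod w < delta)%R -> (Cmod (Lambda w - w) <= eps * Cmod w)%R)
  (halpha : rd_continuous T alpha) : rd_continuous T (cylinder Lambda T alpha).
Proof.
  intros t ht. destruct (halpha t ht) as [h1 h2]. split.
  - intros hd. apply filterlim_limit_within.
    replace (cylinder Lambda T alpha t) with (alpha t).
    2:{ unfold cylinder. destruct Req_dec_T as [|n]; trivial.
        exfalso; apply n. unfold graininess. unfold right_dense in hd. lra. }
    apply cylinder_limit; auto.
    + intros eps heps. now apply graininess_right_dense_limit.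
    + now apply filterlim_limit_within, h1.
  - intros hd. destruct (h2 hd) as [l hl]. exists l.
    apply filterlim_limit_within. apply cylinder_limit; trivial.
    + now intros s [hs _].
    + intros eps heps. exists eps; split; trivial. intros s [hs hst].
      now apply graininess_left_limit.
    + now apply filterlim_limit_within.
Qed.

(** Right-density matters: at a right-scattered point the chain rule fails, the
    exponential being multiplied by [Cexp] of the increment. *)
Lemma delta_derive_Cexp (T : R -> Prop) (F : R -> C) (t : R) (l : C) (ht : T t)
  (hd : right_dense T t) (hF : is_delta_derive T F t l) :
  is_delta_derive T (fun s => Cexp (F s)) t (l * Cexp (F t)).
Proof.
  rewrite delta_derive_iff in *. intros eps heps. rewrite hd in *.
  set (c := Cexp (F t)). assert (hc := Cmod_ge_0 c). assert (hl := Cmod_ge_0 l).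
  set (K := ((Cmod c + 1) * (Cmod l + 2))%R).
  assert (hK : (0 < K)%R) by (apply Rmult_lt_0_compat; lra).
  set (e := Rmin 1 (eps / K)).
  assert (heK : (0 < eps / K)%R) by now apply Rdiv_lt_0_compat.
  assert (he : (0 < e)%R) by (apply Rmin_case; lra).
  assert (he1 : (e <= 1)%R) by apply Rmin_l. assert (he2 : (e <= eps / K)%R) by apply Rmin_r.
  destruct (Cexp_estimate e he) as (d1 & hd1 & H1).
  destruct (hF e he) as (d2 & hd2 & H2).
  assert (hd3 : (0 < d1 / (Cmod l + 1))%R) by (apply Rdiv_lt_0_compat; lra).
  exists (Rmin d2 (d1 / (Cmod l + 1))). split; [apply Rmin_case; lra|].
  intros s hs hst.
  assert (k1 := Rmin_l d2 (d1 / (Cmod l + 1))). assert (k2 := Rmin_r d2 (d1 / (Cmod l + 1))).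
  specialize (H2 s hs ltac:(lra)). rewrite Rabs_minus_sym in hst.
  set (h := Rabs (t - s)) in *. assert (hh : (0 <= h)%R) by apply Rabs_pos.
  set (v := F s - F t).
  replace (F t - F s - l * RtoC (t - s)%R) with (- (v + l * RtoC (t - s)%R)) in H2
    by (unfold v; ring).
  rewrite Cmod_opp in H2.
  assert (hv : (Cmod v <= (Cmod l + e) * h)%R).
  { replace v with ((v + l * RtoC (t - s)%R) + - (l * RtoC (t - s)%R)) by ring.
    eapply Rle_trans; [apply Cmod_triangle|]. rewrite Cmod_opp, Cmod_mult, Cmod_R.
    fold h. lra. }
  assert (hvd : (Cmod v < d1)%R).
  { apply Rle_lt_trans with ((Cmod l + 1) * h)%R; [nra|].
    replace d1 with ((Cmod l + 1) * (d1 / (Cmod l + 1)))%R by (field; lra).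
    apply Rmult_lt_compat_l; lra. }
  specialize (H1 v hvd).
  assert (hE : Cexp (F s) = Cexp v * c).
  { unfold c. rewrite <- Cexp_plus. f_equal. unfold v; ring. }
  replace (c - Cexp (F s) - l * c * RtoC (t - s)%R) with
    (- (c * ((Cexp v - 1 - v) + (v + l * RtoC (t - s)%R)))) by (rewrite hE; ring).
  rewrite Cmod_opp, Cmod_mult.
  assert (hsum : (Cmod ((Cexp v - 1 - v) + (v + l * RtoC (t - s)%R))
                    <= (Cmod l + 2) * (e * h))%R).
  { eapply Rle_trans; [apply Cmod_triangle|].
    assert (e * Cmod v <= e * ((Cmod l + 1) * h))%R; [|lra].
    apply Rmult_le_compat_l; [lra|]. nra. }
  apply Rle_trans with (Cmod c * ((Cmod l + 2) * (e * h)))%R; [now apply Rmult_le_compat_l|].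
  assert (heh : (e * h <= eps / K * h)%R) by now apply Rmult_le_compat_r.
  assert (heh0 : (0 <= e * h)%R) by (apply Rmult_le_pos; lra).
  apply Rle_trans with (K * (e * h))%R.
  - unfold K. assert (0 <= (Cmod l + 2) * (e * h))%R by (apply Rmult_le_pos; lra). lra.
  - replace (eps * h)%R with (K * (eps / K * h))%R by (field; lra).
    apply Rmult_le_compat_l; lra.
Qed.

Lemma Cexp_continuous (D : R -> Prop) (F : R -> C) (t : R)
  (hF : limit_within D F t (F t)) : limit_within D (fun s => Cexp (F s)) t (Cexp (F t)).
Proof.
  intros eps heps. set (c := Cexp (F t)). assert (hc := Cmod_ge_0 c).
  destruct (Cexp_estimate 1 Rlt_0_1) as (d1 & hd1 & H1).
  set (e := (eps / (2 * (Cmod c + 1)))%R).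
  assert (he : (0 < e)%R) by (apply Rdiv_lt_0_compat; lra).
  destruct (hF (Rmin d1 e)) as (d & hd & H); [apply Rmin_case; lra|].
  exists d; split; trivial. intros s hs hst. specialize (H s hs hst).
  assert (k1 := Rmin_l d1 e). assert (k2 := Rmin_r d1 e).
  set (v := F s - F t) in *. specialize (H1 v ltac:(lra)). rewrite Rmult_1_l in H1.
  assert (hE : Cexp (F s) = Cexp v * c).
  { unfold c. rewrite <- Cexp_plus. f_equal. unfold v; ring. }
  replace (Cexp (F s) - c) with (c * ((Cexp v - 1 - v) + v)) by (rewrite hE; ring).
  rewrite Cmod_mult.
  assert (hs2 : (Cmod ((Cexp v - 1 - v) + v) <= 2 * Cmod v)%R).
  { eapply Rle_trans; [apply Cmod_triangle|]. lra. }
  apply Rle_lt_trans with (Cmod c * (2 * Cmod v))%R; [now apply Rmult_le_compat_l|].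
  replace eps with ((Cmod c + 1) * (2 * e))%R by (unfold e; field; lra).
  assert (hv := Cmod_ge_0 v). nra.
Qed.

Lemma cayley_ivp_solvable (T : R -> Prop) (hT : closed T) (alpha : R -> C) (t0 : R)
  (halpha : rd_continuous T alpha)
  (hreg : forall t, T t -> alpha t * graininess T t <> 2 /\ alpha t * graininess T t <> - (2)) :
  exists x, cayley_ivp T alpha t0 x.
Proof.
  destruct cayley_logarithm as (Lambda & HL1 & HL2).
  destruct (rd_continuous_antiderivative T hT _ (cylinder_rd_continuous Lambda T alpha HL2 halpha))
    as [F HF].
  exists (fun t => Cexp (- F t0) * Cexp (F t)). split.
  { rewrite <- Cexp_plus. replace (- F t0 + F t0) with (RtoC 0) by ring. apply Cexp_0. }
  intros t [ht _]. specialize (HF t ht).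
  assert (HE : is_delta_derive T (fun s => Cexp (F s)) t
                 (alpha t * mean T (fun s => Cexp (F s)) t)).
  { destruct (sigma_ge T t ht) as [hlt|heq].
    - assert (hm : graininess T t <> 0%R) by (unfold graininess; lra).
      assert (hmC : RtoC (graininess T t) <> 0) by (intros q; injection q; trivial).
      destruct (hreg t ht) as [h1 h2].
      assert (hj := delta_derive_jump T F t _ ht HF).
      unfold cylinder in hj. destruct Req_dec_T as [|_]; [contradiction|].
      set (w := alpha t * graininess T t) in *.
      replace (Lambda w / graininess T t * graininess T t) with (Lambda w) in hj by (field; trivial).
      assert (hx : Cexp (F (sigma T t)) = Cexp (F t) * cayley w).
      { rewrite hj, Cexp_plus, HL1; trivial. }
      apply delta_derive_right_scattered; trivial.
      + eapply Cexp_continuous, delta_derive_continuous; [trivial|exact HF].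
      + unfold mean. rewrite hx.
        replace (alpha t * ((Cexp (F t) + Cexp (F t) * cayley w) / 2) * graininess T t)
          with (w / 2 * (Cexp (F t) + Cexp (F t) * cayley w)) by (unfold w; field).
        assert (hq : cayley w * (1 - w / 2) = 1 + w / 2) by now apply cayley_mult_denominator.
        replace (Cexp (F t) * cayley w) with
          (Cexp (F t) * (cayley w * (1 - w / 2)) + Cexp (F t) * cayley w * (w / 2)) at 1 by ring.
        rewrite hq. ring.
    - assert (hd : right_dense T t) by (symmetry; exact heq).
      apply delta_derive_ext with (f := fun s => Cexp (F s))
        (l := cylinder Lambda T alpha t * Cexp (F t)); trivial.
      + unfold mean. rewrite <- heq. unfold cylinder.
        destruct Req_dec_T as [_|n]; [field|exfalso; apply n; unfold graininess; lra].
      + now apply delta_derive_Cexp. }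
  apply (delta_derive_ext T (fun s => Cexp (- F t0) * Cexp (F s) + 0 * Cexp (F s)) _ t
    (Cexp (- F t0) * (alpha t * mean T (fun s => Cexp (F s)) t)
       + 0 * (alpha t * mean T (fun s => Cexp (F s)) t))).
  - intros s; ring.
  - unfold mean; field.
  - now apply delta_derive_linear.
Qed.

Lemma E_solves (T : R -> Prop) (hT : closed T) (alpha : R -> C)
  (halpha : rd_continuous T alpha)
  (hreg : forall t, T t -> alpha t * graininess T t <> 2 /\ alpha t * graininess T t <> - (2)) :
  cayley_ivp T alpha 0 (E T alpha).
Proof. unfold E, cayley_exp. apply epsilon_spec. now apply cayley_ivp_solvable. Qed.

Lemma rd_continuous_scal (T : R -> Prop) (f g : R -> C) (c : C)
  (hg : forall t, g t = c * f t) (hf : rd_continuous T f) : rd_continuous T g.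
Proof.
  assert (H : forall D t l, limit_within D f t l -> limit_within D g t (c * l)).
  { intros D t l h eps heps. assert (hc := Cmod_ge_0 c).
    destruct (h (eps / (Cmod c + 1))%R) as (d & hd & H); [apply Rdiv_lt_0_compat; lra|].
    exists d; split; trivial. intros s hs hst. specialize (H s hs hst).
    rewrite hg. replace (c * f s - c * l) with (c * (f s - l)) by ring. rewrite Cmod_mult.
    replace eps with ((Cmod c + 1) * (eps / (Cmod c + 1)))%R by (field; lra).
    assert (h0 := Cmod_ge_0 (f s - l)). nra. }
  intros t ht. destruct (hf t ht) as [h1 h2]. split.
  - intros hd. rewrite hg. apply filterlim_limit_within, H, filterlim_limit_within; auto.
  - intros hd. destruct (h2 hd) as [l hl]. exists (c * l).
    now apply filterlim_limit_within, H, filterlim_limit_within.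
Qed.

Lemma cayley_product_one (T : R -> Prop) (hT : closed T) (alpha x y : R -> C) (t0 : R)
  (h0 : T t0) (hx : cayley_ivp T alpha t0 x) (hy : cayley_ivp T (fun s => - alpha s) t0 y) :
  forall t, T t -> x t * y t = 1.
Proof.
  destruct hx as [hx0 hx]. destruct hy as [hy0 hy].
  assert (hp : forall t, Tkappa T t -> is_delta_derive T (fun s => x s * y s) t 0).
  { intros t ht.
    apply (delta_derive_ext T (fun s => x s * y s) _ t
      (alpha t * mean T x t * mean T y t + mean T x t * (- alpha t * mean T y t)));
      [trivial|ring|].
    apply delta_derive_mult; [apply ht|auto|auto]. }
  intros t ht. transitivity (x t0 * y t0); [|rewrite hx0, hy0; ring].
  destruct (Rle_lt_dec t0 t) as [h|h].
  - now apply (zero_delta_derive_constant T hT (fun s => x s * y s) hp).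
  - symmetry. apply (zero_delta_derive_constant T hT (fun s => x s * y s) hp); trivial; lra.
Qed.

(** Common source of the hyperbolic and trigonometric formulas: the latter have
    [Ci * omega] for [alpha], with a factor [/ Ci] moved to the sine. *)
Lemma cayley_half_sum_difference (T : R -> Prop) (alpha x y : R -> C) (t0 : R)
  (hx : cayley_ivp T alpha t0 x) (hy : cayley_ivp T (fun s => - alpha s) t0 y)
  (t : R) (ht : Tkappa T t) :
  is_delta_derive T (fun s => (x s + y s) / 2) t
    (alpha t * mean T (fun s => (x s - y s) / 2) t) /\
  is_delta_derive T (fun s => (x s - y s) / 2) t
    (alpha t * mean T (fun s => (x s + y s) / 2) t).
Proof.
  assert (hx' := proj2 hx t ht). assert (hy' := proj2 hy t ht). split.
  - apply (delta_derive_ext T (fun s => / 2 * x s + / 2 * y s) _ t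
      (/ 2 * (alpha t * mean T x t) + / 2 * (- alpha t * mean T y t))).
    + intros s; field.
    + unfold mean; field.
    + now apply delta_derive_linear.
  - apply (delta_derive_ext T (fun s => / 2 * x s + (- / 2) * y s) _ t
      (/ 2 * (alpha t * mean T x t) + (- / 2) * (- alpha t * mean T y t))).
    + intros s; field.
    + unfold mean; field.
    + now apply delta_derive_linear.
Qed.

Theorem theorem4p1 (T : R -> Prop) (alpha omega : R -> C)
  (hT : time_scale T) (h0 : T 0%R)
  (halpha : rd_continuous T alpha) (homega : rd_continuous T omega)
  (halpha2 : forall t : R, T t ->
     alpha t * graininess T t <> 2 /\ alpha t * graininess T t <> - (2))
  (homega2 : forall t : R, T t ->
     omega t * graininess T t <> 2 * Ci /\ omega t * graininess T t <> - (2 * Ci)) :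
  (forall t : R, T t ->
     Cosh T alpha t ^ 2 - Sinh T alpha t ^ 2 = 1 /\
     Cos T omega t ^ 2 + Sin T omega t ^ 2 = 1) /\
  (forall t : R, Tkappa T t ->
     is_delta_derive T (Cosh T alpha) t (alpha t * mean T (Sinh T alpha) t) /\
     is_delta_derive T (Sinh T alpha) t (alpha t * mean T (Cosh T alpha) t) /\
     is_delta_derive T (Cos T omega) t (- omega t * mean T (Sin T omega) t) /\
     is_delta_derive T (Sin T omega) t (omega t * mean T (Cos T omega) t)).
Proof.
  destruct hT as [_ hT].
  set (beta := fun s => Ci * omega s).
  assert (hbeta : rd_continuous T beta) by now apply rd_continuous_scal with omega Ci.
  assert (hopp : forall a, rd_continuous T a -> rd_continuous T (fun s => - a s)).
  { intros a ha. apply rd_continuous_scal with a (- (1)); trivial. intros t; ring. }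
  assert (hCi : Ci * Ci = - (1)) by (unfold Ci, Cmult, Copp, RtoC; simpl; f_equal; ring).
  assert (hbeta2 : forall t : R, T t ->
     beta t * graininess T t <> 2 /\ beta t * graininess T t <> - (2)).
  { intros t ht. destruct (homega2 t ht) as [h1 h2]. unfold beta.
    assert (e : omega t * graininess T t = - (Ci * (Ci * omega t * graininess T t))).
    { replace (Ci * (Ci * omega t * graininess T t))
        with (Ci * Ci * (omega t * graininess T t)) by ring. rewrite hCi; ring. }
    split; intros q; rewrite e, q in *; [apply h2|apply h1]; ring. }
  assert (hopp2 : forall a : R -> C,
    (forall t : R, T t -> a t * graininess T t <> 2 /\ a t * graininess T t <> - (2)) ->
    forall t : R, T t -> - a t * graininess T t <> 2 /\ - a t * graininess T t <> - (2)).
  { intros a ha t ht. destruct (ha t ht) as [h1 h2].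
    assert (e : a t * graininess T t = - (- a t * graininess T t)) by ring.
    split; intros q; rewrite e, q in *; [apply h2|apply h1]; ring. }
  assert (xa := E_solves T hT alpha halpha halpha2).
  assert (ya := E_solves T hT _ (hopp _ halpha) (hopp2 _ halpha2)).
  assert (xb := E_solves T hT beta hbeta hbeta2).
  assert (yb := E_solves T hT _ (hopp _ hbeta) (hopp2 _ hbeta2)).
  assert (pa := cayley_product_one T hT _ _ _ _ h0 xa ya).
  assert (pb := cayley_product_one T hT _ _ _ _ h0 xb yb).
  assert (hCi0 : Ci <> 0) by (intros q; injection q; lra).
  assert (hdiv : forall z, z / (2 * Ci) = - Ci * (z / 2)).
  { intros z. replace (- Ci) with (- (Ci * Ci) / Ci) by (field; trivial).
    rewrite hCi. field; trivial. }
  split.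
  - intros t ht. specialize (pa t ht). specialize (pb t ht). split.
    + unfold Cosh, Sinh. rewrite <- pa. field.
    + unfold Cos, Sin. rewrite hdiv, <- pb. fold beta.
      change (fun s => - (Ci * omega s)) with (fun s => - beta s).
      set (x := E T beta t). set (y := E T (fun s => - beta s) t).
      replace ((- Ci * ((x - y) / 2)) ^ 2) with (Ci * Ci * ((x - y) / 2) ^ 2) by ring.
      rewrite hCi. field.
  - intros t ht.
    destruct (cayley_half_sum_difference T alpha _ _ _ xa ya t ht) as [da1 da2].
    destruct (cayley_half_sum_difference T beta _ _ _ xb yb t ht) as [db1 db2].
    repeat split; [exact da1|exact da2| |].
    + eapply delta_derive_ext; [| |exact db1]; [reflexivity|].
      unfold mean, Sin. rewrite !hdiv. fold beta.
      change (fun s => - (Ci * omega s)) with (fun s => - beta s).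
      unfold beta at 1. field.
    + apply (delta_derive_ext T (fun s => - Ci * ((E T beta s - E T (fun s => - beta s) s) / 2)
        + 0 * ((E T beta s - E T (fun s => - beta s) s) / 2)) _ t
        (- Ci * (beta t * mean T (Cos T omega) t) + 0 * (beta t * mean T (Cos T omega) t))).
      * intros s. unfold Sin. rewrite hdiv. unfold beta. ring.
      * unfold beta. replace (- Ci * (Ci * omega t * mean T (Cos T omega) t))
          with (- (Ci * Ci) * (omega t * mean T (Cos T omega) t)) by ring.
        rewrite hCi. ring.
      * now apply delta_derive_linear.
Qed.
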